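(* Let $\mathbf{C}$ be one of the categories $\mathbf{NL}_{\mathrm{IPLH}}$, $\mathbf{NL}_{\mathrm{AIPLH}}$, $\mathbf{NL}_{\mathrm{LH}}$, $\mathbf{NS}$, and let $\bigl((E_i)_{i\in I},(\varphi_{ji})_{i,j\in I,\,j\geq i}\bigr)$ be a direct system in $\mathbf{C}$. Then it has a direct limit in $\mathbf{C}$. If $\bigl(E,(\varphi_i)_{i\in I}\bigr)$ is any direct limit of the system in $\mathbf{C}$, then $E=\bigcup_{i}\varphi_i(E_i)$, $\varphi_i(E_i)\subseteq\varphi_j(E_j)$ whenever $i\leq j$, and: - if $\mathbf{C}=\mathbf{NL}_{\mathrm{IPLH}}$, then the $\varphi_i(E_i)$ are ideals in $E$; - if $\mathbf{C}=\mathbf{NL}_{\mathrm{AIPLH}}$, then the $\varphi_i(E_i)$ are vector sublattices of $E$ and the closures $\overline{\varphi_i(E_i)}$ are ideals in $E$; - if $\mathbf{C}=\mathbf{NL}_{\mathrm{LH}}$, then the $\varphi_i(E_i)$ are vector sublattices of $E$; - if $\mathbf{C}=\mathbf{NS}$, then the $\varphi_i(E_i)$ are linear subspaces of $E$. Furthermore, $\bigl(E,(\varphi_i)_{i\in I}\bigr)$ is also a direct limit of $\bigl((E_i),(\varphi_{ji})_{j\geq i}\bigr)$ in every category to the right of $\mathbf{C}$ in the chain $$\mathbf{NL}_{\mathrm{IPLH}}\subset\mathbf{NL}_{\mathrm{AIPLH}}\subset\mathbf{NL}_{\mathrm{LH}}\subset\mathbf{PONS}_{\mathrm{Pos}}\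to\mathbf{NS}\subset\mathbf{Met}.$$
   Context: All vector spaces are real. A normed lattice is a normed vector lattice. A lattice homomorphism is a vector lattice homomorphism. A contraction between normed spaces is a linear map of norm at most $1$; a contractive map between metric spaces is a map $f$ with $d(f(x),f(y))\leq d(x,y)$. A linear map $\varphi\colon E\to F$ between vector lattices is interval preserving if it is positive and $\varphi([0,x])=[0,\varphi(x)]$ for all $x\in E^+$; a linear map $\varphi\colon E\to F$ from a vector lattice into a normed lattice is almost interval preserving if it is positive and $[0,\varphi(x)]=\overline{\varphi([0,x])}$ (norm closure in $F$) for all $x\in E^+$. A preordered normed space is a normed space with a linear preorder induced by a wedge (not necessarily a cone, not necessarily generating or closed). Categories: $\mathbf{NL}_{\mathrm{IPLH}}$: normed lattices and contractive interval preserving lattice homomorphisms. $\mathbf{NL}_{\mathrm{AIPLH}}$: normed lattices and contractive almost interval preserving lattice homomorphisms. $\mathbf{NL}_{\mathrm{LH}}$: normed lattices and contractive lattice homomorphisms. $\mathbf{PONS}_{\mathrm{Pos}}$: preordered normed spaces and positive contractions. $\mathbf{NS}$: normed spaces and contractions. $\mathbf{Met}$: metric spaces and contractive maps. In the chain, inclusions are subcategory relations and the arrow is the obvious forgetful functor; ''is also a direct limit in a category to the right'' means that the image of the limit under the appropriate composition of inclusion/forgetful functors is a direct limit of the image of the system. Direct systems and limits in a category: let $I$ be a non-empty directed set. A direct system over $I$ consists of objects $O_i$ ($i\in I$) and morphisms $\varphi_{ji}\colon O_i\to O_j$ for $j\geq i$ such that $\varphi_{ii}$ is the identity and $\varphi_{kj}\circ\varphi_{ji}=\varphi_{ki}$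 for $i\leq j\leq k$. A system $(O,(\varphi_i))$ of an object $O$ and morphisms $\varphi_i\colon O_i\to O$ is compatible if $\varphi_j\circ\varphi_{ji}=\varphi_i$ for all $j\geq i$. A direct limit is a compatible system $(O,(\varphi_i))$ such that, for every compatible system $(O',(\varphi_i'))$, there is a unique morphism $\chi\colon O\to O'$ with $\varphi_i'=\chi\circ\varphi_i$ for all $i$. *)

(* Defs.v *)
From HB Require Import structures.
From mathcomp Require Import all_boot all_order all_algebra.
From mathcomp Require Import all_classical all_reals.
From mathcomp Require Import topology normedtype.

Set Implicit Arguments.
Unset Strict Implicit.
Unset Printing Implicit Defensive.

Import Order.TTheory GRing.Theory Num.Theory.
Import numFieldNormedType.Exports.

Local Open Scope classical_set_scope.
Local Open Scope ring_scope.

Record category := Category {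
  obj :> Type;
  hom : obj -> obj -> Type;
  idm : forall A, hom A A;
  compm : forall A B C, hom B C -> hom A B -> hom A C;
  compm1 : forall A B (f : hom A B), compm f (idm A) = f;
  comp1m : forall A B (f : hom A B), compm (idm B) f = f;
  compmA : forall A B C D (h : hom C D) (g : hom B C) (f : hom A B),
    compm h (compm g f) = compm (compm h g) f }.

Arguments idm {c} A : rename.
Arguments compm {c A B C} g f : rename.

Record functor (C D : category) := Functor {
  fobj :> C -> D;
  fmap : forall A B, hom A B -> hom (fobj A) (fobj B);
  fmap_id : forall A, fmap (idm A) = idm (fobj A);
  fmap_comp : forall A B E (g : hom B E) (f : hom A B),
    fmap (compm g f) = compm (fmap g) (fmap f) }.

Arguments fmap {C D} F {A B} f : rename.

Section functor_comp.
Variables (C D E : category) (G : functor D E) (F : functor C D).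

Fact functor_comp_id (A : C) : fmap G (fmap F (idm A)) = idm (G (F A)).
Proof. by rewrite !fmap_id. Qed.

Fact functor_comp_comp (A B K : C) (g : hom B K) (f : hom A B) :
  fmap G (fmap F (compm g f)) = compm (fmap G (fmap F g)) (fmap G (fmap F f)).
Proof. by rewrite !fmap_comp. Qed.

Definition functor_comp : functor C E :=
  Functor functor_comp_id functor_comp_comp.

End functor_comp.

(* The relation of a directed set is a preorder; antisymmetry is not required. *)
Record directedSet := DirectedSet {
  dset :> Type;
  dle : dset -> dset -> Prop;
  dset_inhabited : inhabited dset;
  dle_refl : forall i, dle i i;
  dle_trans : forall i j k, dle i j -> dle j k -> dle i k;
  dle_directed : forall i j, exists k, dle i k /\ dle j k }.

Record directSystem (C : category) (I : directedSet) := DirectSystem {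
  sys_obj :> I -> C;
  sys_map : forall i j, dle i j -> hom (sys_obj i) (sys_obj j);
  sys_map_id : forall i (ii : dle i i), sys_map ii = idm (sys_obj i);
  sys_map_comp : forall i j k (ij : dle i j) (jk : dle j k) (ik : dle i k),
    compm (sys_map jk) (sys_map ij) = sys_map ik }.

Arguments sys_map {C I} S {i j} ij : rename.

Record compatSystem (C : category) (I : directedSet) (S : directSystem C I) :=
  CompatSystem {
    apex :> C;
    leg : forall i, hom (S i) apex;
    leg_compat : forall i j (ij : dle i j),
      compm (leg j) (sys_map S ij) = leg i }.

Arguments leg {C I S} L i : rename.

Definition is_direct_limit (C : category) (I : directedSet)
    (S : directSystem C I) (L : compatSystem S) :=
  forall L' : compatSystem S,
    exists! chi : hom L L', forall i, leg L' i = compm chi (leg L i).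

Section functor_image.
Variables (C D : category) (F : functor C D) (I : directedSet).
Variable S : directSystem C I.

Fact image_system_id i (ii : dle i i) :
  fmap F (sys_map S ii) = idm (F (S i)).
Proof. by rewrite sys_map_id fmap_id. Qed.

Fact image_system_comp i j k (ij : dle i j) (jk : dle j k) (ik : dle i k) :
  compm (fmap F (sys_map S jk)) (fmap F (sys_map S ij)) =
  fmap F (sys_map S ik).
Proof. by rewrite -fmap_comp (@sys_map_comp _ _ S _ _ _ ij jk ik). Qed.

Definition image_system : directSystem D I :=
  @DirectSystem D I (fun i => F (S i)) _ image_system_id image_system_comp.

Variable L : compatSystem S.

Fact image_compat_compat i j (ij : dle i j) :
  compm (fmap F (leg L j)) (sys_map image_system ij) = fmap F (leg L i).
Proof. by rewrite /= -fmap_comp leg_compat. Qed.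

Definition image_compat : compatSystem image_system :=
  @CompatSystem D I image_system (F L) _ image_compat_compat.

End functor_image.

Section concrete_category.
Variables (Ob : Type) (car : Ob -> Type).
Variable P : forall A B, (car A -> car B) -> Prop.
Hypothesis P_id : forall A, P (id : car A -> car A).
Hypothesis P_comp : forall A B C (g : car B -> car C) (f : car A -> car B),
  P g -> P f -> P (g \o f).

Definition concrete_hom A B := {f : car A -> car B | P f}.

Lemma concrete_hom_eq A B (f g : concrete_hom A B) : sval f = sval g -> f = g.
Proof.
case: f g => [f Pf] [g Pg] /= fg; move: Pf; rewrite fg => Pf.
by congr exist; exact: Prop_irrelevance.
Qed.

Definition concrete_id A : concrete_hom A A := exist _ id (P_id A).

Definition concrete_comp A B C (g : concrete_hom B C) (f : concrete_hom A B) :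
    concrete_hom A C :=
  exist _ (sval g \o sval f) (P_comp (svalP g) (svalP f)).

Fact concrete_comp1 A B (f : concrete_hom A B) :
  concrete_comp f (concrete_id A) = f.
Proof. exact: concrete_hom_eq. Qed.

Fact concrete_comp1m A B (f : concrete_hom A B) :
  concrete_comp (concrete_id B) f = f.
Proof. exact: concrete_hom_eq. Qed.

Fact concrete_compA A B C D (h : concrete_hom C D) (g : concrete_hom B C)
    (f : concrete_hom A B) :
  concrete_comp h (concrete_comp g f) = concrete_comp (concrete_comp h g) f.
Proof. exact: concrete_hom_eq. Qed.

Definition concrete_category : category :=
  Category concrete_comp1 concrete_comp1m concrete_compA.

End concrete_category.

(* Mathematical Components has no join of its norms with its non-total orders
   (they only meet in Num.NumDomain), so the order relation and the lattice
   operations of normed lattices are given by separate mixins. *)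

HB.mixin Record isPreorderedLmodule (R : numDomainType) V
    of GRing.Lmodule R V := {
  lev : V -> V -> Prop;
  lev_refl : forall x, lev x x;
  lev_trans : forall y x z, lev x y -> lev y z -> lev x z;
  lev_wD2r : forall z x y, lev x y -> lev (x + z) (y + z);
  lev_wpZ2l : forall (a : R) x y, 0 <= a -> lev x y -> lev (a *: x) (a *: y) }.

#[short(type="preorderedLmodType")]
HB.structure Definition PreorderedLmodule (R : numDomainType) :=
  {V of GRing.Lmodule R V & isPreorderedLmodule R V}.

Notation "x <=v y" := (lev x y) (at level 70, y at next level).

Arguments lev_trans {R s} y {x z} : rename.
Arguments lev_wD2r {R s} z {x y} : rename.
Arguments lev_wpZ2l {R s} a {x y} : rename.

(* The wedge inducing the preorder. *)
Definition wedge (R : numDomainType) (V : preorderedLmodType R) : set V :=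
  [set x | 0 <=v x].

Lemma lev_wedge (R : numDomainType) (V : preorderedLmodType R) (x y : V) :
  x <=v y <-> wedge (y - x).
Proof.
split=> [/(lev_wD2r (- x))|/(lev_wD2r x)]; first by rewrite subrr.
by rewrite add0r subrK.
Qed.

Definition order_interval (R : numDomainType) (V : preorderedLmodType R)
  (x y : V) : set V := [set z | x <=v z /\ z <=v y].

HB.mixin Record isVectorLattice (R : numDomainType) V
    of PreorderedLmodule R V := {
  lev_anti : forall x y : V, x <=v y -> y <=v x -> x = y;
  meetv : V -> V -> V;
  joinv : V -> V -> V;
  levI : forall x y z : V, z <=v meetv x y <-> z <=v x /\ z <=v y;
  leUv : forall x y z : V, joinv x y <=v z <-> x <=v z /\ y <=v z }.

#[short(type="vectorLatticeType")]
HB.structure Definition VectorLattice (R : numDomainType) :=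
  {V of PreorderedLmodule R V & isVectorLattice R V}.

Arguments lev_anti {R s x y} : rename.

Definition absv (R : numDomainType) (V : vectorLatticeType R) (x : V) : V :=
  joinv x (- x).

#[short(type="preorderedNormedModType")]
HB.structure Definition PreorderedNormedModule (R : numDomainType) :=
  {V of NormedModule R V & PreorderedLmodule R V}.

HB.mixin Record isNormedLattice (R : numDomainType) V
    of NormedModule R V & VectorLattice R V := {
  ler_norm_absv : forall x y : V, absv x <=v absv y -> `|x| <= `|y| }.

#[short(type="normedLatticeType")]
HB.structure Definition NormedLattice (R : numDomainType) :=
  {V of NormedModule R V & VectorLattice R V & isNormedLattice R V}.

Section subsets.
Variables (R : numDomainType).

Definition linear_subspace (V : lmodType R) (A : set V) := submod_closed (mem A).

Definition vector_sublattice (V : vectorLatticeType R) (A : set V) :=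
  linear_subspace A /\
  forall x y, A x -> A y -> A (joinv x y) /\ A (meetv x y).

Definition lattice_ideal (V : vectorLatticeType R) (A : set V) :=
  linear_subspace A /\ forall x y, A y -> absv x <=v absv y -> A x.

End subsets.

Section maps.
Variable R : numDomainType.

Definition norm_contractive (E F : normedModType R) (f : E -> F) :=
  forall x, `|f x| <= `|x|.

Definition positive_map (E F : preorderedLmodType R) (f : E -> F) :=
  forall x, 0 <=v x -> 0 <=v f x.

Definition lattice_morphism (E F : vectorLatticeType R) (f : E -> F) :=
  [/\ linear f, {morph f : x y / joinv x y} & {morph f : x y / meetv x y}].

Definition interval_preserving (E F : vectorLatticeType R) (f : E -> F) :=
  positive_map f /\ forall x, 0 <=v x ->
    f @` order_interval 0 x = order_interval 0 (f x).

Definition almost_interval_preserving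
    (E : vectorLatticeType R) (F : normedLatticeType R) (f : E -> F) :=
  positive_map f /\ forall x, 0 <=v x ->
    order_interval 0 (f x) = closure (f @` order_interval 0 x).

Definition metric_contractive (E F : metricType R) (f : E -> F) :=
  forall x y, mdist (f x) (f y) <= mdist x y.

End maps.

Section closed_intervals.
Variables (R : realType).

Lemma closure_normP (V : normedModType R) (A : set V) (x : V) :
  closure A x <-> forall e, 0 < e -> exists2 y, A y & `|x - y| < e.
Proof.
split=> [Ax e e0|Ax B].
  have [|y [Ay]] := Ax (ball x e); first exact: nbhsx_ballx.
  by rewrite -ball_normE => xy; exists y.
move=> /nbhs_normP[e /= e0 eB]; have [y Ay xy] := Ax _ e0.
by exists y; split => //; exact: eB.
Qed.

Lemma levUl (V : vectorLatticeType R) (x y : V) : x <=v joinv x y.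
Proof. by have [] := (leUv x y (joinv x y)).1 (lev_refl _). Qed.

Lemma levUr (V : vectorLatticeType R) (x y : V) : y <=v joinv x y.
Proof. by have [] := (leUv x y (joinv x y)).1 (lev_refl _). Qed.

Lemma levD (V : preorderedLmodType R) (x y z t : V) :
  x <=v y -> z <=v t -> x + z <=v y + t.
Proof.
move=> xy zt; apply: (lev_trans _ (lev_wD2r z xy)).
by rewrite ![y + _]addrC; exact: lev_wD2r.
Qed.

Lemma absv_ge0 (V : vectorLatticeType R) (x : V) : 0 <=v absv x.
Proof.
have := levD (levUl x (- x)) (levUr x (- x)).
rewrite subrr -mulr2n -scaler_nat => /(lev_wpZ2l 2^-1).
by rewrite scaler0 scalerA mulVf ?pnatr_eq0// scale1r; apply; rewrite invr_ge0.
Qed.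

Lemma absv_id (V : vectorLatticeType R) (x : V) : 0 <=v x -> absv x = x.
Proof.
move=> x0; apply: lev_anti; last exact: levUl.
apply/leUv; split; first exact: lev_refl.
by apply: (lev_trans _ _ x0); have := lev_wD2r (- x) x0; rewrite add0r subrr.
Qed.

Lemma normed_lattice_wedge_closed (E : normedLatticeType R) (x : E) :
  closure (wedge (V := E)) x -> 0 <=v x.
Proof.
move=> /closure_normP x0; pose n := joinv (- x) 0.
have n0 : 0 <=v n by exact: levUr.
suff -> : x = x + n.
  by have := lev_wD2r x (levUl (- x) 0); rewrite addNr addrC.
suff : n = 0 by move=> ->; rewrite addr0.
apply/normr0_eq0/eqP; rewrite eq_le normr_ge0 andbT.
apply/ler_addgt0Pr => e e0; rewrite add0r.
have [y /= y0 xy] := x0 _ e0; apply: le_trans (ltW xy).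
apply: ler_norm_absv; rewrite absv_id//.
apply/leUv; split; last exact: absv_ge0.
apply: (lev_trans _ _ (levUr _ _)); rewrite opprB.
by have := lev_wD2r (- x) y0; rewrite add0r.
Qed.

Lemma order_interval_closed (E : normedLatticeType R) (a b : E) :
  closure (order_interval a b) = order_interval a b.
Proof.
apply/seteqP; split; last exact: subset_closure.
move=> x /closure_normP abx; split; apply/lev_wedge;
  apply: normed_lattice_wedge_closed; apply/closure_normP => e /abx[y [ay yb]].
- move=> xy; exists (y - a); first exact: (lev_wedge _ _).1.
  by rewrite opprB addrA subrK.
- move=> xy; exists (b - y); first exact: (lev_wedge _ _).1.
  by rewrite opprB addrC addrA subrK distrC.
Qed.

End closed_intervals.

Section metric_of_norm.
Variables (R : realType) (E : normedModType R).

Definition norm_dist (x y : E) : R := `|x - y|.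

Fact norm_dist_ge0 x y : 0 <= norm_dist x y.
Proof. exact: normr_ge0. Qed.

Fact norm_dist_positivity x y : norm_dist x y = 0 -> x = y.
Proof. by move/normr0_eq0/eqP; rewrite subr_eq0 => /eqP. Qed.

Fact norm_dist_ball (x : E) (d : R) : ball x d = [set y | norm_dist x y < d].
Proof. by rewrite -ball_normE. Qed.

Definition metric_of_norm : metricType R :=
  HB.pack (E : Type) (NormedModule.class E)
    (PseudoMetric_isMetric.Build R E
      norm_dist_ge0 norm_dist_positivity norm_dist_ball).

End metric_of_norm.

Section categories.
Variable R : realType.

Section morphisms.
Variables (E F : normedLatticeType R) (f : E -> F).

Definition NL_IPLH_morphism :=
  [/\ lattice_morphism f, interval_preserving f & norm_contractive f].

Definition NL_AIPLH_morphism :=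
  [/\ lattice_morphism f, almost_interval_preserving f & norm_contractive f].

Definition NL_LH_morphism := lattice_morphism f /\ norm_contractive f.

End morphisms.

Definition PONS_morphism (E F : preorderedNormedModType R) (f : E -> F) :=
  [/\ linear f, positive_map f & norm_contractive f].

Definition NS_morphism (E F : normedModType R) (f : E -> F) :=
  linear f /\ norm_contractive f.

Lemma lattice_morphism_id (E : vectorLatticeType R) :
  lattice_morphism (id : E -> E).
Proof. by []. Qed.

Lemma lattice_morphism_comp (E F G : vectorLatticeType R)
    (g : F -> G) (f : E -> F) :
  lattice_morphism g -> lattice_morphism f -> lattice_morphism (g \o f).
Proof.
move=> [gL gU gI] [fL fU fI].
by split=> [a x y|x y|x y] /=; rewrite ?(fL, fU, fI) ?(gL, gU, gI).
Qed.

Lemma lattice_morphism_lev (E F : vectorLatticeType R) (f : E -> F) (x y : E) :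
  lattice_morphism f -> x <=v y -> f x <=v f y.
Proof.
move=> [_ fU _] xy; suff <- : f (joinv x y) = f y by rewrite fU; exact: levUl.
by congr f; apply: lev_anti; [apply/leUv; split => //; exact: lev_refl|exact: levUr].
Qed.

Lemma linear_fun0 (E F : lmodType R) (f : E -> F) : linear f -> f 0 = 0.
Proof.
by move=> fL; have := fL (-1) 0 0; rewrite scaler0 addr0 scaleN1r addNr.
Qed.

Lemma linear_funB (E F : lmodType R) (f : E -> F) (x y : E) :
  linear f -> f (x - y) = f x - f y.
Proof.
by move=> fL; have := fL (-1) y x; rewrite !scaleN1r ![- _ + _]addrC.
Qed.

Lemma lattice_morphism_positive (E F : vectorLatticeType R) (f : E -> F) :
  lattice_morphism f -> positive_map f.
Proof.
move=> fM x x0; have [fL _ _] := fM.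
by rewrite -(linear_fun0 fL); exact: lattice_morphism_lev.
Qed.

Lemma norm_contractive_id (E : normedModType R) :
  norm_contractive (id : E -> E).
Proof. by move=> x /=. Qed.

Lemma norm_contractive_comp (E F G : normedModType R)
    (g : F -> G) (f : E -> F) :
  norm_contractive g -> norm_contractive f -> norm_contractive (g \o f).
Proof. by move=> gC fC x /=; exact: le_trans (gC _) (fC _). Qed.

Fact NL_LH_id (E : normedLatticeType R) : NL_LH_morphism (id : E -> E).
Proof. by split; [exact: lattice_morphism_id|exact: norm_contractive_id]. Qed.

Fact NL_LH_comp (E F G : normedLatticeType R) (g : F -> G) (f : E -> F) :
  NL_LH_morphism g -> NL_LH_morphism f -> NL_LH_morphism (g \o f).
Proof.
move=> [gM gC] [fM fC].
by split; [exact: lattice_morphism_comp|exact: norm_contractive_comp].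
Qed.

Fact NL_IPLH_id (E : normedLatticeType R) : NL_IPLH_morphism (id : E -> E).
Proof.
split; [exact: lattice_morphism_id| |exact: norm_contractive_id].
by split=> // x x0; rewrite image_id.
Qed.

Fact NL_IPLH_comp (E F G : normedLatticeType R) (g : F -> G) (f : E -> F) :
  NL_IPLH_morphism g -> NL_IPLH_morphism f -> NL_IPLH_morphism (g \o f).
Proof.
move=> [gM [gP gI] gC] [fM [fP fI] fC]; split.
- exact: lattice_morphism_comp.
- split=> x x0 /=; first by apply: gP; exact: fP.
  by rewrite -image_comp fI// gI//; exact: fP.
- exact: norm_contractive_comp.
Qed.

Fact NL_AIPLH_id (E : normedLatticeType R) : NL_AIPLH_morphism (id : E -> E).
Proof.
split; [exact: lattice_morphism_id| |exact: norm_contractive_id].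
by split=> // x x0; rewrite image_id order_interval_closed.
Qed.

Fact NL_AIPLH_comp (E F G : normedLatticeType R) (g : F -> G) (f : E -> F) :
  NL_AIPLH_morphism g -> NL_AIPLH_morphism f -> NL_AIPLH_morphism (g \o f).
Proof.
move=> [gM [gP gI] gC] [fM [fP fI] fC]; split.
- exact: lattice_morphism_comp.
- split=> x x0 /=; first by apply: gP; exact: fP.
  rewrite gI; last exact: fP.
  apply/seteqP; split; last first.
    apply: closureS => _ [y y0x <-]; exists (f y) => //.
    by rewrite fI//; apply: subset_closure; exists y.
  move=> z /closure_normP gz; apply/closure_normP => e e0.
  have e20 : 0 < e / 2 by rewrite divr_gt0.
  have [_ [y + <-] zy] := gz _ e20; rewrite fI// => /closure_normP fy.
  have [_ [t tx <-] yt] := fy _ e20; exists (g (f t)); first by exists t.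
  rewrite (splitr e) -(subrK (g y) z) -addrA.
  apply: le_lt_trans (ler_normD _ _) _; apply: ltrD => //.
  have [gL _ _] := gM; rewrite -linear_funB//.
  exact: le_lt_trans (gC _) yt.
- exact: norm_contractive_comp.
Qed.

Fact PONS_id (E : preorderedNormedModType R) : PONS_morphism (id : E -> E).
Proof. by split => //; exact: norm_contractive_id. Qed.

Fact PONS_comp (E F G : preorderedNormedModType R) (g : F -> G) (f : E -> F) :
  PONS_morphism g -> PONS_morphism f -> PONS_morphism (g \o f).
Proof.
move=> [gL gP gC] [fL fP fC]; split; last exact: norm_contractive_comp.
- by move=> a x y /=; rewrite fL gL.
- by move=> x x0; apply: gP; exact: fP.
Qed.

Fact NS_id (E : normedModType R) : NS_morphism (id : E -> E).
Proof. by split => //; exact: norm_contractive_id. Qed.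

Fact NS_comp (E F G : normedModType R) (g : F -> G) (f : E -> F) :
  NS_morphism g -> NS_morphism f -> NS_morphism (g \o f).
Proof.
move=> [gL gC] [fL fC]; split; last exact: norm_contractive_comp.
by move=> a x y /=; rewrite fL gL.
Qed.

Fact Met_id (E : metricType R) : metric_contractive (id : E -> E).
Proof. by move=> x y. Qed.

Fact Met_comp (E F G : metricType R) (g : F -> G) (f : E -> F) :
  metric_contractive g -> metric_contractive f -> metric_contractive (g \o f).
Proof. by move=> gC fC x y /=; exact: le_trans (gC _ _) (fC _ _). Qed.

Definition NL_IPLH : category := concrete_category NL_IPLH_id NL_IPLH_comp.
Definition NL_AIPLH : category := concrete_category NL_AIPLH_id NL_AIPLH_comp.
Definition NL_LH : category := concrete_category NL_LH_id NL_LH_comp.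
Definition PONS_Pos : category := concrete_category PONS_id PONS_comp.
Definition NS : category := concrete_category NS_id NS_comp.
Definition Met : category := concrete_category Met_id Met_comp.

Fact NL_IPLH_AIPLH (E F : normedLatticeType R) (f : E -> F) :
  NL_IPLH_morphism f -> NL_AIPLH_morphism f.
Proof.
by move=> [fM [fP fI] fC]; split=> //; split=> // x x0;
  rewrite fI// order_interval_closed.
Qed.

Fact NL_AIPLH_LH (E F : normedLatticeType R) (f : E -> F) :
  NL_AIPLH_morphism f -> NL_LH_morphism f.
Proof. by case. Qed.

Fact NL_LH_PONS (E F : normedLatticeType R) (f : E -> F) :
  NL_LH_morphism f -> PONS_morphism f.
Proof.
move=> [fM fC]; have [fL _ _] := fM.
by split=> //; exact: lattice_morphism_positive.
Qed.

Fact PONS_NS (E F : preorderedNormedModType R) (f : E -> F) :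
  PONS_morphism f -> NS_morphism f.
Proof. by case. Qed.

Fact NS_Met (E F : normedModType R) (f : E -> F) :
  NS_morphism f ->
  metric_contractive (f : metric_of_norm E -> metric_of_norm F).
Proof.
move=> [fL fC] x y; rewrite /mdist/= /norm_dist.
by rewrite -linear_funB//; exact: fC.
Qed.

Definition IPLH_to_AIPLH_obj (E : NL_IPLH) : NL_AIPLH := E.

Definition IPLH_to_AIPLH_map (E F : NL_IPLH) (f : hom E F) :
    hom (IPLH_to_AIPLH_obj E) (IPLH_to_AIPLH_obj F) :=
  exist _ (sval f) (NL_IPLH_AIPLH (svalP f)).

Fact IPLH_to_AIPLH_id (E : NL_IPLH) : IPLH_to_AIPLH_map (idm E) = idm (IPLH_to_AIPLH_obj E).
Proof. exact: concrete_hom_eq. Qed.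

Fact IPLH_to_AIPLH_comp (E F G : NL_IPLH) (g : hom F G) (f : hom E F) :
  IPLH_to_AIPLH_map (compm g f) = compm (IPLH_to_AIPLH_map g) (IPLH_to_AIPLH_map f).
Proof. exact: concrete_hom_eq. Qed.

Definition IPLH_to_AIPLH : functor NL_IPLH NL_AIPLH := Functor IPLH_to_AIPLH_id IPLH_to_AIPLH_comp.

Definition AIPLH_to_LH_obj (E : NL_AIPLH) : NL_LH := E.

Definition AIPLH_to_LH_map (E F : NL_AIPLH) (f : hom E F) :
    hom (AIPLH_to_LH_obj E) (AIPLH_to_LH_obj F) :=
  exist _ (sval f) (NL_AIPLH_LH (svalP f)).

Fact AIPLH_to_LH_id (E : NL_AIPLH) : AIPLH_to_LH_map (idm E) = idm (AIPLH_to_LH_obj E).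
Proof. exact: concrete_hom_eq. Qed.

Fact AIPLH_to_LH_comp (E F G : NL_AIPLH) (g : hom F G) (f : hom E F) :
  AIPLH_to_LH_map (compm g f) = compm (AIPLH_to_LH_map g) (AIPLH_to_LH_map f).
Proof. exact: concrete_hom_eq. Qed.

Definition AIPLH_to_LH : functor NL_AIPLH NL_LH := Functor AIPLH_to_LH_id AIPLH_to_LH_comp.

Definition LH_to_PONS_obj (E : NL_LH) : PONS_Pos :=
  (E : normedLatticeType R).

Definition LH_to_PONS_map (E F : NL_LH) (f : hom E F) :
    hom (LH_to_PONS_obj E) (LH_to_PONS_obj F) :=
  exist _ (sval f) (NL_LH_PONS (svalP f)).

Fact LH_to_PONS_id (E : NL_LH) : LH_to_PONS_map (idm E) = idm (LH_to_PONS_obj E).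
Proof. exact: concrete_hom_eq. Qed.

Fact LH_to_PONS_comp (E F G : NL_LH) (g : hom F G) (f : hom E F) :
  LH_to_PONS_map (compm g f) = compm (LH_to_PONS_map g) (LH_to_PONS_map f).
Proof. exact: concrete_hom_eq. Qed.

Definition LH_to_PONS : functor NL_LH PONS_Pos := Functor LH_to_PONS_id LH_to_PONS_comp.

Definition PONS_to_NS_obj (E : PONS_Pos) : NS :=
  (E : preorderedNormedModType R).

Definition PONS_to_NS_map (E F : PONS_Pos) (f : hom E F) :
    hom (PONS_to_NS_obj E) (PONS_to_NS_obj F) :=
  exist _ (sval f) (PONS_NS (svalP f)).

Fact PONS_to_NS_id (E : PONS_Pos) : PONS_to_NS_map (idm E) = idm (PONS_to_NS_obj E).
Proof. exact: concrete_hom_eq. Qed.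

Fact PONS_to_NS_comp (E F G : PONS_Pos) (g : hom F G) (f : hom E F) :
  PONS_to_NS_map (compm g f) = compm (PONS_to_NS_map g) (PONS_to_NS_map f).
Proof. exact: concrete_hom_eq. Qed.

Definition PONS_to_NS : functor PONS_Pos NS := Functor PONS_to_NS_id PONS_to_NS_comp.

Definition NS_to_Met_obj (E : NS) : Met := metric_of_norm E.

Definition NS_to_Met_map (E F : NS) (f : hom E F) :
    hom (NS_to_Met_obj E) (NS_to_Met_obj F) :=
  exist _ (sval f) (NS_Met (svalP f)).

Fact NS_to_Met_id (E : NS) : NS_to_Met_map (idm E) = idm (NS_to_Met_obj E).
Proof. exact: concrete_hom_eq. Qed.

Fact NS_to_Met_comp (E F G : NS) (g : hom F G) (f : hom E F) :
  NS_to_Met_map (compm g f) = compm (NS_to_Met_map g) (NS_to_Met_map f).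
Proof. exact: concrete_hom_eq. Qed.

Definition NS_to_Met : functor NS Met := Functor NS_to_Met_id NS_to_Met_comp.

(* Composites along the chain
   NL_IPLH -> NL_AIPLH -> NL_LH -> PONS_Pos -> NS -> Met. *)
Definition PONS_to_Met : functor PONS_Pos Met :=
  functor_comp NS_to_Met PONS_to_NS.
Definition LH_to_NS : functor NL_LH NS := functor_comp PONS_to_NS LH_to_PONS.
Definition LH_to_Met : functor NL_LH Met := functor_comp PONS_to_Met LH_to_PONS.
Definition AIPLH_to_PONS : functor NL_AIPLH PONS_Pos :=
  functor_comp LH_to_PONS AIPLH_to_LH.
Definition AIPLH_to_NS : functor NL_AIPLH NS :=
  functor_comp LH_to_NS AIPLH_to_LH.
Definition AIPLH_to_Met : functor NL_AIPLH Met :=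
  functor_comp LH_to_Met AIPLH_to_LH.
Definition IPLH_to_LH : functor NL_IPLH NL_LH :=
  functor_comp AIPLH_to_LH IPLH_to_AIPLH.
Definition IPLH_to_PONS : functor NL_IPLH PONS_Pos :=
  functor_comp AIPLH_to_PONS IPLH_to_AIPLH.
Definition IPLH_to_NS : functor NL_IPLH NS :=
  functor_comp AIPLH_to_NS IPLH_to_AIPLH.
Definition IPLH_to_Met : functor NL_IPLH Met :=
  functor_comp AIPLH_to_Met IPLH_to_AIPLH.

End categories.

(* Main.v *)
(* The limit is the algebraic direct limit of the [E_i] modulo the null space
   of the seminorm [N x = inf_j |phi_ji x|]. Joins pass to this quotient because
   [|x \/ y - x' \/ y'| <= |x - x'| + |y - y'|], and meets are recovered as
   [x + y - x \/ y].

   A compatible system is a direct limit as soon as its legs cover it and each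
   distance in it is, up to epsilon, attained at some index: every competing
   system then factors through it by a contractive map of metric spaces, and
   this map inherits linearity, positivity, lattice operations and (almost)
   interval preservation from the legs. This criterion does not see the
   category, so it passes to all categories further right in the chain, and it
   is invariant under isomorphism, so every direct limit satisfies it. *)

From HB Require Import structures.
From mathcomp Require Import all_boot all_order all_algebra.
From mathcomp Require Import all_classical all_reals.
From mathcomp Require Import topology normedtype.
Require Import Defs.

Set Implicit Arguments.
Unset Strict Implicit.
Unset Printing Implicit Defensive.

Import Order.TTheory GRing.Theory Num.Theory.
Import numFieldNormedType.Exports.

Local Open Scope classical_set_scope.
Local Open Scope ring_scope.

(** * Vector lattices *)

Section preordered_modules.
Variables (R : realType) (V : preorderedLmodType R).
Implicit Types x y a : V.

Lemma levD2r a x y : x + a <=v y + a <-> x <=v y.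
Proof.
split; last exact: lev_wD2r.
by move=> /(lev_wD2r (- a)); rewrite !addrK.
Qed.

Lemma levBlDr a x y : x - a <=v y <-> x <=v y + a.
Proof. by rewrite -(levD2r a) subrK. Qed.

Lemma levBrDr a x y : x <=v y - a <-> x + a <=v y.
Proof. by rewrite -(levD2r a) subrK. Qed.

End preordered_modules.

Section vector_lattices.
Variables (R : realType) (V : vectorLatticeType R).
Implicit Types x y z a b c : V.

Lemma joinvC x y : joinv x y = joinv y x.
Proof.
by apply: lev_anti; apply/leUv; split;
  [exact: levUr|exact: levUl|exact: levUr|exact: levUl].
Qed.

Lemma lev_joinvP x y : joinv x y = y <-> x <=v y.
Proof.
split=> [<-|xy]; first exact: levUl.
by apply: lev_anti; [apply/leUv; split => //; exact: lev_refl|exact: levUr].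
Qed.

Lemma joinvv x : joinv x x = x.
Proof. exact/lev_joinvP/lev_refl. Qed.

Lemma levU2 x y a b : x <=v a -> y <=v b -> joinv x y <=v joinv a b.
Proof.
move=> xa yb; apply/leUv; split.
  exact: lev_trans xa (levUl _ _).
exact: lev_trans yb (levUr _ _).
Qed.

Lemma joinvA x y z : joinv x (joinv y z) = joinv (joinv x y) z.
Proof.
apply: lev_anti.
  apply/leUv; split; first exact: lev_trans (levUl _ _) (levUl _ _).
  by apply: levU2 (lev_refl _); exact: levUr.
apply/leUv; split; last exact: lev_trans (levUr _ _) (levUr _ _).
by apply: levU2 (lev_refl _) _; exact: levUl.
Qed.

Lemma joinvDr x y z : joinv (x + z) (y + z) = joinv x y + z.
Proof.
apply: lev_anti.
  by apply/leUv; split; apply/levD2r; [exact: levUl|exact: levUr].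
apply/levBrDr/leUv.
by split; apply/levBrDr; [exact: levUl|exact: levUr].
Qed.

Lemma joinvZ (t : R) x y : 0 <= t -> joinv (t *: x) (t *: y) = t *: joinv x y.
Proof.
have join_le s (u v : V) : 0 <= s -> joinv (s *: u) (s *: v) <=v s *: joinv u v.
  by move=> s0; apply/leUv; split; apply: lev_wpZ2l => //;
    [exact: levUl|exact: levUr].
rewrite le_eqVlt => /predU1P[<-|t0]; first by rewrite !scale0r joinvv.
apply: lev_anti; first exact/join_le/ltW.
(* The other inequality is [join_le] at the scalar [t^-1], multiplied by [t]. *)
have t'0 : 0 <= t^-1 by rewrite invr_ge0 ltW.
have := join_le t^-1 (t *: x) (t *: y) t'0.
rewrite !scalerK ?gt_eqF// => /(lev_wpZ2l t (ltW t0)).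
by rewrite scalerKV ?gt_eqF.
Qed.

(** Because of this formula only joins have to be followed through linear maps and through the
    quotient. Translating [joinv x y] by [meetv x y] gives the join of two elements below
    [x + y]. *)
Lemma meetv_joinv x y : meetv x y = x + y - joinv x y.
Proof.
have [mx my] := (levI x y (meetv x y)).1 (lev_refl _).
apply: lev_anti.
  apply/(levD2r (joinv x y)); rewrite subrK addrC -joinvDr.
  apply/leUv; split; first by apply: levD => //; exact: lev_refl.
  by rewrite [x + y]addrC; apply: levD => //; exact: lev_refl.
apply/levI; split; apply/levBlDr.
  by rewrite ![x + _]addrC; apply: lev_wD2r; exact: levUr.
by rewrite [y + _]addrC; apply: lev_wD2r; exact: levUl.
Qed.

Lemma meetv_lel x y : meetv x y <=v x.
Proof. by have [] := (levI x y (meetv x y)).1 (lev_refl _). Qed.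

Lemma meetv_ler x y : meetv x y <=v y.
Proof. by have [] := (levI x y (meetv x y)).1 (lev_refl _). Qed.

Lemma meetv_l x y : x <=v y -> meetv x y = x.
Proof.
move=> xy; apply: lev_anti (meetv_lel _ _) _.
by apply/levI; split=> //; exact: lev_refl.
Qed.

Lemma absvN x : absv (- x) = absv x.
Proof. by rewrite /absv opprK joinvC. Qed.

Lemma lev_absv x : x <=v absv x.
Proof. exact: levUl. Qed.

Lemma absv_le x y : x <=v y -> - x <=v y -> absv x <=v y.
Proof. by move=> xy Nxy; apply/leUv. Qed.

(** Since [u] lies below [v + absv (u - v)], both [x] and [y] lie below [joinv a b] plus the two
    absolute values. *)
Lemma lev_sub_joinv x y a b :
  joinv x y - joinv a b <=v absv (x - a) + absv (y - b).
Proof.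
apply/levBlDr; have absvD0 (u v : V) : u <=v v + absv (u - v).
  by apply/(levD2r (- v)); rewrite [_ + absv _]addrC addrK; exact: lev_absv.
apply/leUv; split.
  apply: lev_trans (absvD0 _ a) _; rewrite addrC -addrA; apply: levD.
    exact: lev_refl.
  rewrite -{1}[a]add0r; apply: levD; [exact: absv_ge0|exact: levUl].
apply: lev_trans (absvD0 _ b) _; rewrite addrC [absv (x - a) + _]addrC -addrA.
apply: levD; first exact: lev_refl.
rewrite -{1}[b]add0r; apply: levD; [exact: absv_ge0|exact: levUr].
Qed.

Lemma absv_sub_joinv x y a b :
  absv (joinv x y - joinv a b) <=v absv (x - a) + absv (y - b).
Proof.
apply: absv_le; first exact: lev_sub_joinv.
by rewrite opprB -(absvN (x - a)) -(absvN (y - b)) !opprB; exact: lev_sub_joinv.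
Qed.

(** The element [meetv x a - absv (a - b)] is a lower bound of both [x] and [b]; exchanging [a] and
    [b] gives the other sign. *)
Lemma absv_sub_meetv x a b : absv (meetv x a - meetv x b) <=v absv (a - b).
Proof.
have meet_le (u v : V) : meetv x u - meetv x v <=v absv (u - v).
  apply/levBlDr; rewrite addrC; apply/levBlDr; apply/levI; split; apply/levBlDr.
    apply: lev_trans (meetv_lel _ _) _; rewrite -[x in x <=v _]addr0.
    by apply: levD; [exact: lev_refl|exact: absv_ge0].
  apply: lev_trans (meetv_ler _ _) _; rewrite addrC.
  by apply/levBlDr; exact: lev_absv.
apply: absv_le; first exact: meet_le.
by rewrite opprB -absvN opprB; exact: meet_le.
Qed.

Lemma absv_sub_absv x y : absv (absv x - absv y) <=v absv (x - y).
Proof.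
have absvB (u v : V) : absv u - absv v <=v absv (u - v).
  apply/levBlDr; apply: absv_le.
    rewrite -[u in u <=v _](subrK v); apply: levD; exact: lev_absv.
  rewrite -absvN opprB -(absvN v) -{1}[- u](subrK (- v)).
  by apply: levD; last exact: lev_absv; rewrite opprK addrC; exact: lev_absv.
apply: absv_le; first exact: absvB.
by rewrite opprB -(absvN (x - y)) opprB; exact: absvB.
Qed.

Lemma joinv0_sub x : x = joinv x 0 - joinv (- x) 0.
Proof.
have -> : joinv x 0 = joinv (- x) 0 + x by rewrite -joinvDr addNr add0r joinvC.
by rewrite addrAC subrr add0r.
Qed.

Lemma joinv0_le_absv x : joinv x 0 <=v absv x.
Proof. by apply/leUv; split; [exact: lev_absv|exact: absv_ge0]. Qed.

End vector_lattices.

Section normed_lattices.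
Variables (R : realType) (V : normedLatticeType R).
Implicit Types x y a b : V.

Lemma norm_absv x : `|absv x| = `|x|.
Proof.
by apply/eqP; rewrite eq_le !ler_norm_absv// (absv_id (absv_ge0 x)); exact: lev_refl.
Qed.

Lemma norm_sub_joinv x y a b :
  `|joinv x y - joinv a b| <= `|x - a| + `|y - b|.
Proof.
rewrite -(norm_absv (x - a)) -(norm_absv (y - b)) (le_trans _ (ler_normD _ _))//.
apply: ler_norm_absv; rewrite [absv (absv _ + _)]absv_id.
  exact: absv_sub_joinv.
by rewrite -[0]addr0; apply: levD; exact: absv_ge0.
Qed.

End normed_lattices.

(** * Images of morphisms: subspaces, sublattices and ideals *)

Section images.
Variable R : realType.

Lemma range_linear_subspace (E F : lmodType R) (f : E -> F) :
  linear f -> linear_subspace (range f).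
Proof.
move=> fL; split=> [|a u v]; rewrite !inE/=.
  by exists 0 => //; exact: linear_fun0.
by move=> [x _ <-] [y _ <-]; exists (a *: x + y) => //; rewrite fL.
Qed.

Lemma closure_linear_subspace (F : normedModType R) (A : set F) :
  linear_subspace A -> linear_subspace (closure A).
Proof.
move=> [+ AL]; rewrite inE/= => A0; split=> [|a u v]; rewrite !inE/=.
  exact: subset_closure.
move=> /closure_normP Au /closure_normP Av; apply/closure_normP => e e0.
(* The denominator [|a| + 1] stays positive when [a = 0]. *)
have [|u' Au' uu'] := Au (e / 2 / (`|a| + 1)).
  by rewrite !divr_gt0// ltr_wpDl.
have [|v' Av' vv'] := Av (e / 2); first by rewrite divr_gt0.
exists (a *: u' + v'); first by have := AL a u' v'; rewrite !inE/=; exact.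
rewrite opprD addrACA -scalerBr (splitr e) (le_lt_trans (ler_normD _ _))//.
apply: ler_ltD => //; rewrite normrZ.
have a1 : 0 < `|a| + 1 by rewrite ltr_wpDl.
rewrite (@le_trans _ _ ((`|a| + 1) * `|u - u'|))//.
  by rewrite ler_wpM2r// lerDl.
by rewrite mulrC -ler_pdivlMr// ltW.
Qed.

(** Meets follow from joins and linearity through [meetv_joinv]. *)
Lemma lattice_morphism_joinv (E F : vectorLatticeType R) (f : E -> F) :
  linear f -> {morph f : x y / joinv x y} -> lattice_morphism f.
Proof.
move=> fL fU; split=> // x y; rewrite !meetv_joinv linear_funB// fU.
by have := fL 1 x y; rewrite !scale1r => ->.
Qed.

Lemma lattice_morphism_absv (E F : vectorLatticeType R) (f : E -> F) x :
  lattice_morphism f -> f (absv x) = absv (f x).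
Proof.
by move=> [fL fU _]; rewrite /absv fU -[- x]sub0r linear_funB// linear_fun0// sub0r.
Qed.

Lemma range_vector_sublattice (E F : vectorLatticeType R) (f : E -> F) :
  lattice_morphism f -> vector_sublattice (range f).
Proof.
move=> [fL fU fI]; split; first exact: range_linear_subspace.
by move=> _ _ [x _ <-] [y _ <-]; split;
  [exists (joinv x y)|exists (meetv x y)].
Qed.

(* Solidity only has to be tested on positive elements, through
   [x = x^+ - x^-]. *)
Lemma lattice_ideal_positive (F : vectorLatticeType R) (A : set F) :
  linear_subspace A ->
  (forall x y, A y -> 0 <=v x -> x <=v absv y -> A x) -> lattice_ideal A.
Proof.
move=> AL Apos; split=> // x y Ay xy; rewrite [x]joinv0_sub addrC.
have [_ Alin] := AL.
have := Alin (-1) (joinv (- x) 0) (joinv x 0); rewrite !inE/= scaleN1r; apply.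
  apply: Apos Ay (levUr _ _) (lev_trans _ _ xy).
  by rewrite -absvN; exact: joinv0_le_absv.
exact: Apos Ay (levUr _ _) (lev_trans _ (joinv0_le_absv _) xy).
Qed.

(** An element between 0 and [|f y| = f |y|] belongs to the order interval [[0, f |y|]], which is
    the image of [[0, |y|]]. *)
Lemma range_lattice_ideal (E F : vectorLatticeType R) (f : E -> F) :
  lattice_morphism f -> interval_preserving f -> lattice_ideal (range f).
Proof.
move=> fM [_ fI]; apply: lattice_ideal_positive.
  by case: fM => fL _ _; exact: range_linear_subspace.
move=> x _ [y _ <-] x0 xy.
have : order_interval 0 (f (absv y)) x by rewrite lattice_morphism_absv.
by rewrite -fI; [move=> [z _ <-]; exists z|exact: absv_ge0].
Qed.

(** Let [0 <= x <= |y|] and let [y] be near [f z]. Then [meetv x (absv (f z))] lies in [[0, f |z|]],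
    hence in the closure of the range, and it is near [x = meetv x (absv y)] because meets and
    absolute values are nonexpansive. *)
Lemma closure_range_lattice_ideal (E : vectorLatticeType R)
    (F : normedLatticeType R) (f : E -> F) :
  lattice_morphism f -> almost_interval_preserving f ->
  lattice_ideal (closure (range f)).
Proof.
move=> fM [_ fI]; apply: lattice_ideal_positive.
  by case: fM => fL _ _; exact/closure_linear_subspace/range_linear_subspace.
move=> x y /closure_normP fy x0 xy; apply/closure_normP => e e0.
have e20 : 0 < e / 2 by rewrite divr_gt0.
have [_ [z _ <-] yz] := fy _ e20.
have : order_interval 0 (f (absv z)) (meetv x (absv (f z))).
  rewrite lattice_morphism_absv//; split; last exact: meetv_ler.
  by apply/levI; split=> //; exact: absv_ge0.
rewrite fI; last exact: absv_ge0.
move=> /closure_normP /(_ _ e20) [_ [t _ <-] xt]; exists (f t); first by exists t.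
rewrite (splitr e) -(subrK (meetv x (absv (f z))) x) -addrA.
rewrite (le_lt_trans (ler_normD _ _))// ler_ltD//; apply: le_trans (ltW yz).
rewrite -{1}(meetv_l xy).
apply: ler_norm_absv; apply: lev_trans (absv_sub_meetv _ _ _) _.
exact: absv_sub_absv.
Qed.

End images.

(** * The limit space *)

Section limit_space.
Variables (R : realType) (I : directedSet) (S : directSystem (NS R) I).

Let E (i : I) : normedModType R := S i.

Definition transition i j (ij : dle i j) : E i -> E j := sval (sys_map S ij).
Local Notation tr := transition.

Lemma transition_linear i j (ij : dle i j) : linear (tr ij).
Proof. by have [] := svalP (sys_map S ij). Qed.

Lemma transition_contractive i j (ij : dle i j) : norm_contractive (tr ij).
Proof. by have [] := svalP (sys_map S ij). Qed.

HB.instance Definition _ i j (ij : dle i j) :=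
  GRing.isLinear.Build R (E i) (E j) _ (tr ij) (transition_linear ij).

Lemma transition_comp i j k (ij : dle i j) (jk : dle j k) (ik : dle i k) x :
  tr jk (tr ij x) = tr ik x.
Proof. by rewrite /tr -(sys_map_comp S ij jk ik). Qed.

Lemma transition_id i (ii : dle i i) x : tr ii x = x.
Proof. by rewrite /tr sys_map_id. Qed.

Definition limit_seminorm i (x : E i) : R :=
  inf [set r | exists j (ij : dle i j), r = `|tr ij x|].
Local Notation N := limit_seminorm.

Lemma limit_seminorm_le i j (ij : dle i j) x : N x <= `|tr ij x|.
Proof. by apply: ge_inf; [exists 0 => _ [k [ik ->]]|exists j, ij]. Qed.

Lemma le_limit_seminorm i (x : E i) c :
  (forall j (ij : dle i j), c <= `|tr ij x|) -> c <= N x.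
Proof.
move=> cx; apply: lb_le_inf; last by move=> _ [j [ij ->]].
by exists `|tr (dle_refl i) x|, i, (dle_refl i).
Qed.

Lemma limit_seminorm_lt i (x : E i) c :
  N x < c -> exists j (ij : dle i j), `|tr ij x| < c.
Proof.
move=> xc; apply: contrapT => nx; suff : c <= N x by rewrite leNgt xc.
apply: le_limit_seminorm => j ij; rewrite leNgt; apply/negP => ?.
by apply: nx; exists j, ij.
Qed.

Lemma limit_seminorm_ge0 i (x : E i) : 0 <= N x.
Proof. exact: le_limit_seminorm. Qed.

Lemma limit_seminorm_norm i (x : E i) : N x <= `|x|.
Proof.
by rewrite -[in leRHS](transition_id (dle_refl i) x) limit_seminorm_le.
Qed.

(** Norms decrease along the transitions, so the infimum may be restricted to the indices above [j],
    which are cofinal by directedness. *)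
Lemma limit_seminorm_transition i j (ij : dle i j) x : N (tr ij x) = N x.
Proof.
apply/eqP; rewrite eq_le; apply/andP; split.
  apply: le_limit_seminorm => k ik; have [l [jl kl]] := dle_directed j k.
  apply: le_trans (limit_seminorm_le jl _) _.
  have il := dle_trans ik kl.
  by rewrite (transition_comp ij jl il) -(transition_comp ik kl il)
    transition_contractive.
apply: le_limit_seminorm => k jk.
by rewrite (transition_comp ij jk (dle_trans ij jk)) limit_seminorm_le.
Qed.

Lemma limit_seminorm0 i : N (0 : E i) = 0.
Proof.
apply/eqP; rewrite eq_le limit_seminorm_ge0 andbT.
by rewrite (le_trans (limit_seminorm_norm _))// normr0.
Qed.

Lemma limit_seminormZ i a (x : E i) : N (a *: x) = `|a| * N x.
Proof.
have NZ b y : b != 0 -> N (b *: y) <= `|b| * N (y : E i).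
  move=> b0; rewrite -ler_pdivrMl ?normr_gt0//.
  apply: le_limit_seminorm => j ij; rewrite ler_pdivrMl ?normr_gt0// -normrZ.
  by rewrite -linearZ limit_seminorm_le.
have [->|a0] := eqVneq a 0; first by rewrite scale0r normr0 mul0r limit_seminorm0.
(* The lower bound is [NZ] for the scalar [a^-1] and the vector [a *: x]. *)
apply/eqP; rewrite eq_le NZ//= -ler_pdivlMl ?normr_gt0// -normfV.
by rewrite -[in leLHS](scalerK a0 x) NZ// invr_eq0.
Qed.

(** The infima for [y] and [z] are approached at different indices; at a common later index both
    norms have only decreased. This serves the triangle inequality and the estimate for joins
    alike. *)
Lemma limit_seminorm_leD i (x y z : E i) :
  (forall j (ij : dle i j), `|tr ij x| <= `|tr ij y| + `|tr ij z|) ->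
  N x <= N y + N z.
Proof.
move=> xyz; rewrite -lerBlDr; apply: le_limit_seminorm => j ij.
rewrite lerBlDr [leRHS]addrC -lerBlDr; apply: le_limit_seminorm => k ik.
rewrite lerBlDr [leRHS]addrC; have [l [jl kl]] := dle_directed j k.
have il := dle_trans ij jl.
apply: le_trans (limit_seminorm_le il _) _; apply: le_trans (xyz _ _) _.
rewrite -{1}(transition_comp ij jl il) -(transition_comp ik kl il).
by rewrite lerD ?transition_contractive.
Qed.

Lemma limit_seminormD i (x y : E i) : N (x + y) <= N x + N y.
Proof.
by apply: limit_seminorm_leD => j ij; rewrite linearD/= ler_normD.
Qed.

Lemma limit_seminormN i (x : E i) : N (- x) = N x.
Proof. by rewrite -scaleN1r limit_seminormZ normrN1 mul1r. Qed.

Lemma limit_seminormB_eq i (x y : E i) : N (x - y) = 0 -> N x = N y.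
Proof.
move=> xy; apply/eqP; rewrite eq_le; apply/andP; split.
  by rewrite -[in leLHS](subrK y x) (le_trans (limit_seminormD _ _))// xy add0r.
rewrite -[in leLHS](subrK x y) (le_trans (limit_seminormD _ _))//.
by rewrite -opprB limit_seminormN xy add0r.
Qed.

Lemma limit_seminorm_eq0D i (x y : E i) : N x = 0 -> N y = 0 -> N (x + y) = 0.
Proof.
move=> x0 y0; apply/eqP; rewrite eq_le limit_seminorm_ge0 andbT.
by rewrite (le_trans (limit_seminormD _ _))// x0 y0 addr0.
Qed.

(** A single relation performs both the algebraic direct limit and the quotient by the null space of
    the seminorm. *)
Definition germ_eq (s t : {i & E i}) := exists k,
  exists (sk : dle (tag s) k) (tk : dle (tag t) k),
  N (tr sk (tagged s) - tr tk (tagged t)) = 0.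

(** The seminorm is invariant under transitions, so the test at some common index can be replaced by
    the test at any given one. *)
Lemma germ_eqP s t k (sk : dle (tag s) k) (tk : dle (tag t) k) :
  germ_eq s t <-> N (tr sk (tagged s) - tr tk (tagged t)) = 0.
Proof.
split=> [[l [sl [tl Nst]]]|Nst]; last by exists k, sk, tk.
have [m [km lm]] := dle_directed k l.
rewrite -(limit_seminorm_transition km) linearB/=.
rewrite -[RHS]Nst -[in RHS](limit_seminorm_transition lm) linearB/=.
by rewrite (transition_comp _ _ (dle_trans sk km))
  (transition_comp _ _ (dle_trans tk km)) (transition_comp _ _ (dle_trans sk km))
  (transition_comp _ _ (dle_trans tk km)).
Qed.

Lemma germ_eq_sym s t : germ_eq s t -> germ_eq t s.
Proof.
by move=> [k [sk [tk Nst]]]; exists k, tk, sk; rewrite -opprB limit_seminormN.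
Qed.

Lemma germ_eq_trans s t u : germ_eq s t -> germ_eq t u -> germ_eq s u.
Proof.
have [k [sk tk]] := dle_directed (tag s) (tag t).
have [l [kl ul]] := dle_directed k (tag u).
have [sl tl] := (dle_trans sk kl, dle_trans tk kl).
move=> /(germ_eqP sl tl) st /(germ_eqP tl ul) tu; apply/(germ_eqP sl ul).
by rewrite -(subrK (tr tl (tagged t)) (tr sl _)) -addrA limit_seminorm_eq0D.
Qed.

(** Points are the equivalence classes themselves, as sets of tagged elements, so that equivalent
    elements give equal points by extensionality. *)
Definition limit_space := {A : set {i & E i} | exists t, A = germ_eq t}.

HB.instance Definition _ := gen_eqMixin limit_space.
HB.instance Definition _ := gen_choiceMixin limit_space.

Definition germ i (x : E i) : limit_space :=
  exist _ (germ_eq (Tagged E x)) (ex_intro _ (Tagged E x) erefl).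

Lemma germP i (x y : E i) : germ x = germ y <-> N (x - y) = 0.
Proof.
have ii := dle_refl i; rewrite -[x in N (x - _)](transition_id ii x).
rewrite -[y in N (_ - y)](transition_id ii y).
rewrite -(@germ_eqP (Tagged E x) (Tagged E y) i).
split=> [[] /(congr1 (fun A => A (Tagged E y)))->|xy].
  by exists i, ii, ii; rewrite subrr limit_seminorm0.
apply: eq_exist => /=; apply/funext => t; apply/propext; split.
  exact/germ_eq_trans/germ_eq_sym.
exact: germ_eq_trans.
Qed.

Lemma germ_surj (p : limit_space) : exists i (x : E i), p = germ x.
Proof. by case: p => A [[i x] Ax]; exists i, x; exact: eq_exist. Qed.

Lemma germ_transition i j (ij : dle i j) x : germ (tr ij x) = germ x.
Proof.
apply: eq_exist => /=; apply/funext => t; apply/propext.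
have jj := dle_refl j.
have ji : germ_eq (Tagged E (tr ij x)) (Tagged E x).
  by exists j, jj, ij; rewrite /= transition_id subrr limit_seminorm0.
split; first exact/germ_eq_trans/germ_eq_sym.
exact: germ_eq_trans.
Qed.

Lemma germ_common2 p q : exists i (x y : E i), p = germ x /\ q = germ y.
Proof.
have [i [x ->]] := germ_surj p; have [j [y ->]] := germ_surj q.
have [k [ik jk]] := dle_directed i j.
by exists k, (tr ik x), (tr jk y); rewrite !germ_transition.
Qed.

Lemma germ_common3 p q r :
  exists i (x y z : E i), [/\ p = germ x, q = germ y & r = germ z].
Proof.
have [i [x [y [-> ->]]]] := germ_common2 p q; have [j [z ->]] := germ_surj r.
have [k [ik jk]] := dle_directed i j.
by exists k, (tr ik x), (tr ik y), (tr jk z); rewrite !germ_transition.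
Qed.

(** The first condition allows representatives at different indices to be compared, the second makes
    the result independent of null vectors; together they let the operation descend to germs. *)
Definition stable_op (op : forall i, E i -> E i -> E i) :=
  (forall i j (ij : dle i j) x y, tr ij (op i x y) = op j (tr ij x) (tr ij y)) /\
  (forall i (x x' y y' : E i), N (x - x') = 0 -> N (y - y') = 0 ->
    N (op i x y - op i x' y') = 0).

(** The default [p] of [xget] is never returned, since two points always have representatives at a
    common index. *)
Definition lift_op (op : forall i, E i -> E i -> E i) (p q : limit_space) :=
  xget p [set r | exists i (x y : E i),
    [/\ p = germ x, q = germ y & r = germ (op i x y)]].

Lemma lift_opE op i (x y : E i) :
  stable_op op -> lift_op op (germ x) (germ y) = germ (op i x y).
Proof.
move=> [optr opN]; rewrite /lift_op.
case: xgetP => [r _ /= [j [x' [y' [xx yy ->]]]]|].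
  have [k [ik jk]] := dle_directed i j.
  rewrite -(germ_transition ik) -(germ_transition jk) !optr; apply/germP.
  by apply: opN; apply/germP; rewrite !germ_transition.
by move=> /(_ (germ (op i x y)))[]; exists i, x, y.
Qed.

(** The directed set is only known to be inhabited, so an index is extracted by choice;
    [limit_zeroE] shows that all indices give the same point. *)
Definition limit_zero : limit_space :=
  germ (0 : E (sval (cid (let: inhabits i := dset_inhabited I in
                          ex_intro (fun=> True) i Logic.I)))).
Definition limit_add := lift_op (fun i => +%R).
(** Scaling is treated as a binary operation that ignores its second argument, so that [lift_op]
    covers it. *)
Definition limit_scale a p := lift_op (fun i x _ => a *: x) p p.

Lemma limit_zeroE i : limit_zero = germ (0 : E i).
Proof.
rewrite /limit_zero; set j := sval _; have [k [jk ik]] := dle_directed j i.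
by rewrite -(germ_transition jk) -(germ_transition ik) !linear0.
Qed.

Lemma limit_addE i (x y : E i) : limit_add (germ x) (germ y) = germ (x + y).
Proof.
apply: (@lift_opE (fun i => +%R)); split=> [j k jk u v|]; first exact: linearD.
by move=> j u u' v v' uu vv; rewrite opprD addrACA limit_seminorm_eq0D.
Qed.

Lemma limit_scaleE i a (x : E i) : limit_scale a (germ x) = germ (a *: x).
Proof.
apply: (@lift_opE (fun i x _ => a *: x)); split=> [j k jk u v|].
  exact: linearZ.
by move=> j u u' v v' uu _; rewrite -scalerBr limit_seminormZ uu mulr0.
Qed.

Lemma limit_addA : associative limit_add.
Proof.
move=> p q r; have [i [x [y [z [-> -> ->]]]]] := germ_common3 p q r.
by rewrite !limit_addE addrA.
Qed.

Lemma limit_addC : commutative limit_add.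
Proof.
move=> p q; have [i [x [y [-> ->]]]] := germ_common2 p q.
by rewrite !limit_addE addrC.
Qed.

Lemma limit_add0 : left_id limit_zero limit_add.
Proof.
move=> p; have [i [x ->]] := germ_surj p.
by rewrite (limit_zeroE i) limit_addE add0r.
Qed.

Lemma limit_addN : left_inverse limit_zero (limit_scale (-1)) limit_add.
Proof.
move=> p; have [i [x ->]] := germ_surj p.
by rewrite limit_scaleE limit_addE scaleN1r addNr (limit_zeroE i).
Qed.

HB.instance Definition _ :=
  GRing.isZmodule.Build limit_space limit_addA limit_addC limit_add0 limit_addN.

Lemma germD i (x y : E i) : germ (x + y) = germ x + germ y.
Proof. by rewrite -limit_addE. Qed.

Lemma limit_scaleA a b p : limit_scale a (limit_scale b p) = limit_scale (a * b) p.
Proof.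
by have [i [x ->]] := germ_surj p; rewrite !limit_scaleE scalerA.
Qed.

Lemma limit_scale1 : left_id 1 limit_scale.
Proof.
by move=> p; have [i [x ->]] := germ_surj p; rewrite limit_scaleE scale1r.
Qed.

Lemma limit_scaleDr : right_distributive limit_scale +%R.
Proof.
move=> a p q; have [i [x [y [-> ->]]]] := germ_common2 p q.
by rewrite -germD !limit_scaleE -germD scalerDr.
Qed.

Lemma limit_scaleDl p : {morph limit_scale^~ p : a b / a + b}.
Proof.
move=> a b; have [i [x ->]] := germ_surj p.
by rewrite !limit_scaleE -germD scalerDl.
Qed.

HB.instance Definition _ := GRing.Zmodule_isLmodule.Build R limit_space
  limit_scaleA limit_scale1 limit_scaleDr limit_scaleDl.

Lemma germZ i a (x : E i) : germ (a *: x) = a *: germ x.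
Proof. by rewrite -limit_scaleE. Qed.

Lemma germ0 i : germ (0 : E i) = 0.
Proof. by rewrite -limit_zeroE. Qed.

Lemma germ_linear i : linear (@germ i).
Proof. by move=> a x y; rewrite germD germZ. Qed.

(** The default 0 is never returned, since every point is a germ. *)
Definition limit_norm (p : limit_space) : R :=
  xget 0 [set r | exists i (x : E i), p = germ x /\ r = N x].

Lemma limit_normE i (x : E i) : limit_norm (germ x) = N x.
Proof.
rewrite /limit_norm; case: xgetP => [r _ /= [j [y [xy ->]]]|].
  have [k [ik jk]] := dle_directed i j.
  rewrite -(limit_seminorm_transition jk) -(limit_seminorm_transition ik).
  by apply/esym/limit_seminormB_eq/germP; rewrite !germ_transition.
by move=> /(_ (N x))[]; exists i, x.
Qed.

Lemma limit_normD p q : limit_norm (p + q) <= limit_norm p + limit_norm q.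
Proof.
have [i [x [y [-> ->]]]] := germ_common2 p q.
by rewrite -germD !limit_normE limit_seminormD.
Qed.

Lemma limit_normZ a p : limit_norm (a *: p) = `|a| * limit_norm p.
Proof.
have [i [x ->]] := germ_surj p.
by rewrite -germZ !limit_normE limit_seminormZ.
Qed.

Lemma limit_norm_eq0 p : limit_norm p = 0 -> p = 0.
Proof.
have [i [x ->]] := germ_surj p; rewrite limit_normE => x0.
by rewrite -(germ0 i); apply/germP; rewrite subr0.
Qed.

HB.instance Definition _ := Lmodule_isNormed.Build R limit_space
  limit_normD limit_normZ limit_norm_eq0.

Lemma norm_germ i (x : E i) : `|germ x| = N x.
Proof. exact: limit_normE. Qed.

Lemma germ_morphism i : NS_morphism (@germ i).
Proof.
split; first exact: germ_linear.
by move=> x; rewrite norm_germ limit_seminorm_norm.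
Qed.

End limit_space.

(** * The lattice structure on the limit of normed lattices *)

Section limit_lattice.
Variables (R : realType) (I : directedSet) (S : directSystem (NL_LH R) I).

Let T := image_system (LH_to_NS R) S.
Let E (i : I) : normedLatticeType R := S i.
Local Notation tr := (@transition R I T _ _).
Local Notation N := (@limit_seminorm R I T _).
Local Notation germ := (@germ R I T _).

Lemma transition_lattice i j (ij : dle i j) :
  lattice_morphism (tr ij : E i -> E j).
Proof. by have [] := svalP (sys_map S ij). Qed.

Lemma transition_joinv i j (ij : dle i j) (x y : E i) :
  tr ij (joinv x y) = joinv (tr ij x : E j) (tr ij y).
Proof. by have [_ + _] := transition_lattice ij; apply. Qed.

Lemma transition_absv i j (ij : dle i j) (x : E i) :
  tr ij (absv x) = absv (tr ij x : E j).
Proof. by rewrite /absv transition_joinv linearN. Qed.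

Lemma limit_seminorm_absv_le i (x y : E i) : absv x <=v absv y -> N x <= N y.
Proof.
move=> xy; apply: le_limit_seminorm => j ij.
apply: le_trans (limit_seminorm_le ij _) _.
apply: (@ler_norm_absv R (E j)).
by have := lattice_morphism_lev (transition_lattice ij) xy; rewrite !transition_absv.
Qed.

Lemma limit_seminorm_absv i (x : E i) : N (absv x) = N x.
Proof.
apply/eqP; rewrite eq_le !limit_seminorm_absv_le//;
  by rewrite (absv_id (absv_ge0 x)); exact: lev_refl.
Qed.

(** At every index the distance of the joins is at most the sum of the distances of the arguments,
    and [limit_seminorm_leD] carries this over to the seminorm. *)
Lemma joinv_stable : @stable_op R I T (fun i => @joinv R (E i)).
Proof.
split=> [i j ij x y|i x x' y y' xx yy]; first exact: transition_joinv.
suff : N (joinv x y - joinv x' y') <= N (x - x') + N (y - y').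
  rewrite xx yy addr0 => le0.
  by apply/eqP; rewrite eq_le le0 limit_seminorm_ge0.
apply: limit_seminorm_leD => j ij.
by rewrite !linearB/= !transition_joinv; exact: (@norm_sub_joinv R (E j)).
Qed.

(** A separate name to which the order is attached; the limit space of a general system carries only
    a norm. *)
Definition limit_lattice := limit_space T.
HB.instance Definition _ := NormedModule.copy limit_lattice (limit_space T).
Implicit Types p q r : limit_lattice.

Definition limit_join : limit_lattice -> limit_lattice -> limit_lattice :=
  @lift_op R I T (fun i => @joinv R (E i)).

Lemma limit_joinE i (x y : E i) : limit_join (germ x) (germ y) = germ (joinv x y).
Proof. exact: lift_opE joinv_stable. Qed.

Lemma limit_joinvv p : limit_join p p = p.
Proof. by have [i [x ->]] := germ_surj p; rewrite limit_joinE joinvv. Qed.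

Lemma limit_joinC p q : limit_join p q = limit_join q p.
Proof.
have [i [x [y [-> ->]]]] := germ_common2 p q.
by rewrite !limit_joinE joinvC.
Qed.

Lemma limit_joinA p q r :
  limit_join p (limit_join q r) = limit_join (limit_join p q) r.
Proof.
have [i [x [y [z [-> -> ->]]]]] := germ_common3 p q r.
by rewrite !limit_joinE joinvA.
Qed.

Lemma limit_joinDr p q r : limit_join (p + r) (q + r) = limit_join p q + r.
Proof.
have [i [x [y [z [-> -> ->]]]]] := germ_common3 p q r.
by rewrite -!germD !limit_joinE -germD joinvDr.
Qed.

Lemma limit_joinZ a p q :
  0 <= a -> limit_join (a *: p) (a *: q) = a *: limit_join p q.
Proof.
move=> a0; have [i [x [y [-> ->]]]] := germ_common2 p q.
by rewrite -!germZ !limit_joinE -germZ joinvZ.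
Qed.

(** Expressing the order by joins reduces its axioms to identities, and these hold for germs because
    they hold at each index. *)
Definition limit_lev p q := limit_join p q = q.

Lemma limit_lev_trans q p r : limit_lev p q -> limit_lev q r -> limit_lev p r.
Proof. by rewrite /limit_lev => pq <-; rewrite limit_joinA pq. Qed.

Lemma limit_lev_wD2r r p q : limit_lev p q -> limit_lev (p + r) (q + r).
Proof. by rewrite /limit_lev limit_joinDr => ->. Qed.

Lemma limit_lev_wpZ2l a p q :
  0 <= a -> limit_lev p q -> limit_lev (a *: p) (a *: q).
Proof. by rewrite /limit_lev => a0 pq; rewrite limit_joinZ// pq. Qed.

HB.instance Definition _ := isPreorderedLmodule.Build R limit_lattice
  limit_joinvv limit_lev_trans limit_lev_wD2r limit_lev_wpZ2l.

Lemma limit_lev_anti p q : p <=v q -> q <=v p -> p = q.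
Proof. by rewrite /lev/= /limit_lev limit_joinC => -> . Qed.

Lemma limit_leU p q r : limit_join p q <=v r <-> p <=v r /\ q <=v r.
Proof.
rewrite /lev/= /limit_lev; split=> [<-|[pr qr]]; first split.
- by rewrite !limit_joinA limit_joinvv.
- by rewrite [limit_join p q]limit_joinC !limit_joinA limit_joinvv.
- by rewrite -limit_joinA qr pr.
Qed.

(** If [r] lies below [p] and [q], then [limit_join p q + r] is the join of [p + r] and [q + r],
    both below [p + q]. Conversely, the join dominates [q], and cancelling [q] leaves [r] below [p];
    likewise for [q]. *)
Lemma limit_levI p q r : r <=v p + q - limit_join p q <-> r <=v p /\ r <=v q.
Proof.
have [pU qU] := (limit_leU p q (limit_join p q)).1 (lev_refl _).
split=> [/levBrDr rpq|[rp rq]].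
  split; [apply/(levD2r q)|apply/(levD2r p); rewrite [q + p]addrC];
    apply: lev_trans rpq; apply: levD => //; exact: lev_refl.
apply/levBrDr; rewrite addrC -limit_joinDr; apply/limit_leU.
by split; [|rewrite [p + q]addrC]; apply: levD => //; exact: lev_refl.
Qed.

HB.instance Definition _ := isVectorLattice.Build R limit_lattice
  limit_lev_anti limit_levI limit_leU.

Lemma germ_joinv i (x y : E i) :
  germ (joinv x y) = joinv (germ x : limit_lattice) (germ y).
Proof. by rewrite -limit_joinE. Qed.

Lemma germ_absv i (x : E i) : germ (absv x) = absv (germ x : limit_lattice).
Proof. by rewrite /absv germ_joinv -scaleN1r germZ scaleN1r. Qed.

(** The hypothesis says only that [joinv (absv x) (absv y)] and [absv y] have the same germ, not
    that [absv x] lies below [absv y]. Equal germs have equal seminorms, and [absv x] does lie below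
    the join. *)
Lemma limit_norm_absv p q : absv p <=v absv q -> `|p| <= `|q|.
Proof.
have [i [x [y [-> ->]]]] := germ_common2 p q.
rewrite -!germ_absv /lev/= /limit_lev limit_joinE => /germP/limit_seminormB_eq xy.
rewrite !norm_germ -(limit_seminorm_absv y) -xy.
apply: limit_seminorm_absv_le; have xU := levUl (absv x) (absv y).
by rewrite [absv (joinv _ _)]absv_id//; exact: lev_trans (absv_ge0 x) xU.
Qed.

HB.instance Definition _ := isNormedLattice.Build R limit_lattice limit_norm_absv.

End limit_lattice.

(** * A criterion for direct limits *)

Section direct_limits.
Variables (C : category) (I : directedSet) (S : directSystem C I).

(** Both [compm g f] and the identity mediate from [L] to itself, so uniqueness identifies them. *)
Lemma direct_limit_iso (L L0 : compatSystem S) :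
  is_direct_limit L -> is_direct_limit L0 ->
  exists (f : hom L L0) (g : hom L0 L), [/\ compm g f = idm L,
    forall i, leg L0 i = compm f (leg L i) &
    forall i, leg L i = compm g (leg L0 i)].
Proof.
move=> Llim L0lim; have [f [ff _]] := Llim L0; have [g [gg _]] := L0lim L.
exists f, g; split=> //; have [h [_ hu]] := Llim L.
by rewrite -(hu (idm L)) ?(hu (compm g f))// => i;
  [rewrite -compmA -ff|rewrite comp1m].
Qed.

(** Meant for the functors to metric spaces: the limit property is proved there and pulled back. The
    second hypothesis is where a contractive factorization is shown to respect the structure of
    [C]. *)
Lemma is_direct_limit_reflect (D : category) (F : functor C D)
    (L : compatSystem S) :
  (forall A B (f g : hom A B), fmap F f = fmap F g -> f = g) ->
  (forall (L' : compatSystem S) (chi : hom (F L) (F L')),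
    (forall i, fmap F (leg L' i) = compm chi (fmap F (leg L i))) ->
    exists chi', fmap F chi' = chi) ->
  is_direct_limit (image_compat F L) -> is_direct_limit L.
Proof.
move=> Finj Flift Llim L'; have [chi [chiL chiU]] := Llim (image_compat F L').
have [chi' chi'E] := Flift L' chi chiL.
exists chi'; split=> [i|chi'' chi''L].
  by apply: Finj; rewrite fmap_comp chi'E; exact: chiL.
apply: Finj; rewrite chi'E; apply: chiU => i.
by rewrite /= -fmap_comp -chi''L.
Qed.

End direct_limits.

Section exhausting.
Variables (R : realType) (I : directedSet).

(* Stated for the metrics so that all categories of the chain share it. *)
Definition exhausting (C : category) (F : functor C (Met R))
    (S : directSystem C I) (L : compatSystem S) :=
  \bigcup_i range (sval (fmap F (leg L i))) = setT /\
  forall i x y e, 0 < e -> exists j (ij : dle i j),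
    mdist (sval (fmap F (sys_map S ij)) x) (sval (fmap F (sys_map S ij)) y) <
    mdist (sval (fmap F (leg L i)) x) (sval (fmap F (leg L i)) y) + e.

Section to_Met.
Variables (C : category) (F : functor C (Met R)) (S : directSystem C I).

Lemma sval_leg_transition (L : compatSystem S) i j (ij : dle i j) x :
  sval (fmap F (leg L j)) (sval (fmap F (sys_map S ij)) x) =
  sval (fmap F (leg L i)) x.
Proof. by rewrite -(leg_compat L ij) fmap_comp. Qed.

Lemma exhausting_direct_limit (L : compatSystem S) :
  exhausting F L -> is_direct_limit (image_compat F L).
Proof.
move=> [Lcover Lmet] L'; pose f i := sval (fmap F (leg L i)).
pose g i := sval (leg L' i).
have gtr i j (ij : dle i j) x : g j (sval (fmap F (sys_map S ij)) x) = g i x.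
  by rewrite /g -(leg_compat L' ij).
(* Both points move to a common index [k], then to an index [l] at which their distance exceeds the
   one in [L] by less than [e]; the leg of [L'] at [l] is contractive. *)
have gf i j x y : mdist (g i x) (g j y) <= mdist (f i x) (f j y).
  apply/ler_addgt0Pr => e e0; have [k [ik jk]] := dle_directed i j.
  rewrite -(gtr _ _ ik) -(gtr _ _ jk) /f -(sval_leg_transition L ik).
  rewrite -(sval_leg_transition L jk).
  have [l [kl]] := Lmet k (sval (fmap F (sys_map S ik)) x)
    (sval (fmap F (sys_map S jk)) y) _ e0.
  move=> /ltW; apply: le_trans; rewrite -(gtr _ _ kl) -[in leLHS](gtr _ _ kl).
  exact: (svalP (leg L' l)).
have cover p : exists i x, p = f i x.
  have : setT p by [].
  by rewrite -Lcover => -[i _ [x _ <-]]; exists i, x.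
(* Well defined by [gf]: two representatives of [p] have images at distance zero. *)
have /choice[chi chiP] p : exists q, forall i x, p = f i x -> q = g i x.
  have [i [x ->]] := cover p; exists (g i x) => j y fxy.
  apply: mdist_positivity; apply/eqP; rewrite eq_le mdist_ge0 andbT.
  by rewrite (le_trans (gf _ _ _ _))// fxy mdistxx.
have chi_contr : metric_contractive chi.
  move=> p q; have [i [x ->]] := cover p; have [j [y ->]] := cover q.
  by rewrite (chiP _ i x)// (chiP _ j y).
exists (exist _ chi chi_contr); split=> [i|chi' chi'L].
  by apply: concrete_hom_eq; apply/funext => x /=; rewrite (chiP _ i x).
apply: concrete_hom_eq; apply/funext => p /=; have [i [x ->]] := cover p.
rewrite (chiP _ i x)// /g; have := congr1 (fun h => sval h x) (chi'L i).
exact.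
Qed.

(** The two limits are isomorphic compatibly with their legs. Covering passes along the surjection
    [g], and distances in [L0] are at most those in [L] because [f] is contractive. *)
Lemma exhausting_iso (L L0 : compatSystem S) :
  is_direct_limit L -> is_direct_limit L0 ->
  exhausting F L0 -> exhausting F L.
Proof.
move=> Llim L0lim [L0cover L0met].
have [f [g [gf fL gL0]]] := direct_limit_iso Llim L0lim; split.
  apply/seteqP; split=> // p _.
  have : setT (sval (fmap F f) p) by [].
  rewrite -L0cover => -[i _ [x _ fx]]; exists i => //; exists x => //.
  rewrite gL0 fmap_comp /= fx.
  have -> : sval (fmap F g) (sval (fmap F f) p) = sval (fmap F (compm g f)) p.
    by rewrite fmap_comp.
  by rewrite gf fmap_id.
move=> i x y e e0; have [j [ij xy]] := L0met i x y e e0.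
exists j, ij; apply: lt_le_trans xy _; rewrite lerD2r fL fmap_comp /=.
exact: (svalP (fmap F f)).
Qed.

End to_Met.
End exhausting.

(** * Limits of normed spaces and of preordered normed spaces *)

Section limits_in_NS.
Variables (R : realType) (I : directedSet) (S : directSystem (NS R) I).
Implicit Types L : compatSystem S.
Local Notation space L := (apex L : normedModType R).

Lemma leg_cover2 L : \bigcup_i range (sval (leg L i)) = setT ->
  forall p q : space L, exists i x y, p = sval (leg L i) x /\ q = sval (leg L i) y.
Proof.
move=> Lcover p q; have legtr i j (ij : dle i j) x :
    sval (leg L j) (sval (sys_map S ij) x) = sval (leg L i) x.
  by rewrite -(leg_compat L ij).
have cover r : exists i x, r = sval (leg L i) x.
  have : setT r by [].
  by rewrite -Lcover => -[i _ [x _ <-]]; exists i, x.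
have [i [x ->]] := cover p; have [j [y ->]] := cover q.
have [k [ik jk]] := dle_directed i j.
exists k, (sval (sys_map S ik) x), (sval (sys_map S jk) y).
by rewrite !legtr.
Qed.

(** A linear combination of two points is computed at one index, where the legs of both systems are
    linear. The norm bound is the metric one for the distance to 0. *)
Lemma factor_NS_morphism L L' (chi : space L -> space L') :
  \bigcup_i range (sval (leg L i)) = setT ->
  metric_contractive (chi : metric_of_norm (space L) -> metric_of_norm (space L')) ->
  (forall i x, sval (leg L' i) x = chi (sval (leg L i) x)) -> NS_morphism chi.
Proof.
move=> Lcover chiC chiL; have chi_linear : linear chi.
  move=> a p q; have [i [x [y [-> ->]]]] := leg_cover2 Lcover p q.
  have [lL _] := svalP (leg L i); have [lL' _] := svalP (leg L' i).
  by rewrite -lL -!chiL lL'.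
split=> // p; have := chiC p 0.
by rewrite /mdist/= /norm_dist linear_fun0// !subr0.
Qed.

Lemma exhausting_NS L : exhausting (NS_to_Met R) L -> is_direct_limit L.
Proof.
move=> Lex; apply: is_direct_limit_reflect (exhausting_direct_limit Lex).
  by move=> A B f g fg; apply: concrete_hom_eq; exact: (congr1 sval fg).
move=> L' chi chiL; have chiM : NS_morphism (sval chi : space L -> space L').
  apply: factor_NS_morphism; [by case: Lex|exact: svalP|move=> i x].
  exact: (congr1 (fun h => sval h x) (chiL i)).
by exists (exist _ _ chiM); exact: concrete_hom_eq.
Qed.

Definition germ_hom i : hom (S i) (limit_space S : normedModType R) :=
  exist _ _ (@germ_morphism R I S i).

Lemma germ_hom_compat i j (ij : dle i j) :
  compm (germ_hom j) (sys_map S ij) = germ_hom i.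
Proof.
by apply: concrete_hom_eq; apply/funext => x; exact: germ_transition.
Qed.

Definition limit_space_system : compatSystem S := CompatSystem germ_hom_compat.

Lemma limit_space_exhausting : exhausting (NS_to_Met R) limit_space_system.
Proof.
split=> [|i x y e e0].
  apply/seteqP; split=> // p _; have [i [x ->]] := germ_surj p.
  by exists i => //; exists x.
(* The index at which the infimum defining the norm of [germ x - germ y] is attained up to [e]. *)
have [|j [ij xy]] := @limit_seminorm_lt R I S i (x - y) (`|germ x - germ y| + e).
  rewrite -(linear_funB _ _ (@germ_linear R I S i)) norm_germ ltrDl //.
exists j, ij; rewrite /mdist/= /norm_dist -linear_funB//.
exact: transition_linear.
Qed.

End limits_in_NS.

(** The metric criterion says nothing about the wedge of the apex, which need not be covered by the
    wedges of the [S i]. The hypothesis on positive elements supplies this, and with it positivity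
    of the factorization. *)
Lemma exhausting_PONS (R : realType) (I : directedSet)
    (S : directSystem (PONS_Pos R) I) (L : compatSystem S) :
  exhausting (PONS_to_Met R) L ->
  (forall p : (apex L : preorderedNormedModType R), 0 <=v p ->
    exists i, exists2 x, 0 <=v x & p = sval (leg L i) x) ->
  is_direct_limit L.
Proof.
move=> Lex Lpos; apply: is_direct_limit_reflect (exhausting_direct_limit Lex).
  by move=> A B f g fg; apply: concrete_hom_eq; exact: (congr1 sval fg).
move=> L' chi chiL.
have chiE i x : sval (leg L' i) x = sval chi (sval (leg L i) x).
  exact: (congr1 (fun h => sval h x) (chiL i)).
have [chi_linear chi_contr] : NS_morphism
    (sval chi : (apex L : preorderedNormedModType R) ->
                (apex L' : preorderedNormedModType R)).
  apply: (@factor_NS_morphism R I (image_system (PONS_to_NS R) S)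
    (image_compat (PONS_to_NS R) L) (image_compat (PONS_to_NS R) L')).
  - by case: Lex.
  - exact: (svalP chi).
  - exact: chiE.
have chiM : PONS_morphism
    (sval chi : (apex L : preorderedNormedModType R) ->
                (apex L' : preorderedNormedModType R)).
  split=> // p /Lpos[i [x x0 ->]]; rewrite -chiE.
  by have [_ + _] := svalP (leg L' i); apply.
by exists (exist _ _ chiM); exact: concrete_hom_eq.
Qed.

(** * Limits of normed lattices with lattice homomorphisms *)

Section limits_in_NL_LH.
Variables (R : realType) (I : directedSet) (S : directSystem (NL_LH R) I).
Implicit Types L : compatSystem S.
Local Notation lattice L := (apex L : normedLatticeType R).
Let E (i : I) : normedLatticeType R := S i.

(** Replacing a representative by its positive part keeps its image, since legs preserve joins and
    [p] is positive. *)
Lemma leg_positive_cover L : \bigcup_i range (sval (leg L i)) = setT ->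
  forall p : lattice L, 0 <=v p ->
    exists i, exists2 x : E i, 0 <=v x & p = sval (leg L i) x.
Proof.
move=> Lcover p p0; have : setT p by [].
rewrite -Lcover => -[i _ [x _ fx]]; exists i, (joinv (x : E i) 0).
  exact: levUr.
have [[lL lU _] _] := svalP (leg L i).
by rewrite lU fx linear_fun0// joinvC; apply/esym/lev_joinvP.
Qed.

Lemma factor_NL_LH_morphism L L' (chi : lattice L -> lattice L') :
  \bigcup_i range (sval (leg L i)) = setT ->
  metric_contractive
    (chi : metric_of_norm (lattice L) -> metric_of_norm (lattice L')) ->
  (forall i x, sval (leg L' i) x = chi (sval (leg L i) x)) ->
  NL_LH_morphism chi.
Proof.
move=> Lcover chiC chiE; have [chi_linear chi_contr] : NS_morphism chi.
  exact: (@factor_NS_morphism R I (image_system (LH_to_NS R) S)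
    (image_compat (LH_to_NS R) L) (image_compat (LH_to_NS R) L')).
split=> //; apply: lattice_morphism_joinv => // p q.
have [i [x [y [-> ->]]]] := @leg_cover2 R I (image_system (LH_to_NS R) S)
  (image_compat (LH_to_NS R) L) Lcover p q.
have [[_ lU _] _] := svalP (leg L i); have [[_ lU' _] _] := svalP (leg L' i).
by rewrite /= -lU -!chiE lU'.
Qed.

Lemma exhausting_NL_LH L : exhausting (LH_to_Met R) L -> is_direct_limit L.
Proof.
move=> Lex; apply: is_direct_limit_reflect (exhausting_direct_limit Lex).
  by move=> A B f g fg; apply: concrete_hom_eq; exact: (congr1 sval fg).
move=> L' chi chiL; have chiM : NL_LH_morphism (sval chi : lattice L -> lattice L').
  apply: factor_NL_LH_morphism; [by case: Lex|exact: (svalP chi)|move=> i x].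
  exact: (congr1 (fun h => sval h x) (chiL i)).
by exists (exist _ _ chiM); exact: concrete_hom_eq.
Qed.

Lemma germ_NL_LH_morphism i :
  NL_LH_morphism
    (@germ R I (image_system (LH_to_NS R) S) i : E i -> limit_lattice S).
Proof.
have [gL gC] := @germ_morphism R I (image_system (LH_to_NS R) S) i.
split=> //; apply: lattice_morphism_joinv; first exact: gL.
exact: germ_joinv.
Qed.

Definition lattice_germ_hom i : hom (S i) (limit_lattice S : normedLatticeType R) :=
  exist _ _ (germ_NL_LH_morphism i).

Lemma lattice_germ_hom_compat i j (ij : dle i j) :
  compm (lattice_germ_hom j) (sys_map S ij) = lattice_germ_hom i.
Proof.
apply: concrete_hom_eq; apply/funext => x.
exact: (@germ_transition R I (image_system (LH_to_NS R) S)).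
Qed.

Definition limit_lattice_system : compatSystem S :=
  CompatSystem lattice_germ_hom_compat.

Lemma limit_lattice_exhausting : exhausting (LH_to_Met R) limit_lattice_system.
Proof. exact: (limit_space_exhausting (image_system (LH_to_NS R) S)). Qed.

Lemma leg_lattice_morphism L i :
  lattice_morphism (sval (leg L i) : E i -> lattice L).
Proof. by have [] := svalP (leg L i). Qed.

(** Brings an interval of the limit back to an interval at a later index, where the hypotheses on
    the transitions apply. *)
Lemma leg_order_interval L i (x : E i) (p : lattice L) :
  \bigcup_i range (sval (leg L i)) = setT -> 0 <=v x ->
  order_interval 0 (sval (leg L i) x) p -> exists j (ij : dle i j),
  exists2 y : E j, order_interval 0 (sval (sys_map S ij) x : E j) y &
    p = sval (leg L j) y.
Proof.
move=> Lcover x0 [p0 px]; have [k [z z0 pz]] := leg_positive_cover Lcover p0.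
have [j [ij kj]] := dle_directed i k.
have trpos l m (lm : dle l m) : positive_map (sval (sys_map S lm) : E l -> E m).
  by apply: lattice_morphism_positive; have [] := svalP (sys_map S lm).
(* A positive representative of [p] is cut down by the image of [x]; this keeps its own image in the
   limit, as [p] lies below the image of [x]. *)
exists j, ij, (meetv (sval (sys_map S kj) z : E j) (sval (sys_map S ij) x)).
  split; last exact: meetv_ler.
  by apply/levI; split; exact: trpos.
have [_ _ ->] := leg_lattice_morphism L j.
have legtr l m (lm : dle l m) t :
    sval (leg L m) (sval (sys_map S lm) t) = sval (leg L l) t.
  by rewrite -(leg_compat L lm).
by rewrite !legtr -pz meetv_l.
Qed.

(** An element of [[0, phi_i x]] comes from some [y] in [[0, phi_ji x]], and this [y] is itself the
    image of an element of [[0, x]]. *)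
Lemma leg_interval_preserving L : \bigcup_i range (sval (leg L i)) = setT ->
  (forall i j (ij : dle i j),
    interval_preserving (sval (sys_map S ij) : E i -> E j)) ->
  forall i, interval_preserving (sval (leg L i) : E i -> lattice L).
Proof.
move=> Lcover trI i; have legM := leg_lattice_morphism L.
have legP := lattice_morphism_positive (legM i).
split=> // x x0; apply/seteqP; split=> [_ [y [y0 yx] <-]|p /= px].
  by split; [exact: legP|exact: lattice_morphism_lev].
have [j [ij [y xy ->]]] := leg_order_interval Lcover x0 px.
have [_ /(_ x x0)trx] := trI i j ij; move: xy; rewrite -trx => -[z zx <-].
by exists z => //; rewrite -(leg_compat L ij).
Qed.

(** Here [y] is only approximated by images of elements of [[0, x]], and the contractive leg at [j]
    keeps the approximation. *)
Lemma leg_almost_interval_preserving L :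
  \bigcup_i range (sval (leg L i)) = setT ->
  (forall i j (ij : dle i j),
    almost_interval_preserving (sval (sys_map S ij) : E i -> E j)) ->
  forall i, almost_interval_preserving (sval (leg L i) : E i -> lattice L).
Proof.
move=> Lcover trI i; have legM := leg_lattice_morphism L.
have legP := lattice_morphism_positive (legM i).
split=> // x x0; apply/seteqP; split=> [p /= px|]; last first.
  (* Order intervals are closed, so it is enough that the interval contains the image. *)
  rewrite -[X in _ `<=` X]order_interval_closed.
  apply: closureS => _ [y [y0 yx] <-].
  by split; [exact: legP|exact: lattice_morphism_lev].
have [j [ij [y xy ->]]] := leg_order_interval Lcover x0 px.
have [_ /(_ x x0)trx] := trI i j ij; move: xy; rewrite trx => /closure_normP xy.
apply/closure_normP => e /xy[_ [z zx <-] yz]; exists (sval (leg L i) z).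
  by exists z.
have [[legL _ _] legC] := svalP (leg L j).
rewrite -(leg_compat L ij)/= -linear_funB//.
exact: le_lt_trans (legC _) yz.
Qed.

(** A positive [p] is the image of a positive [x], so [[0, chi p]] is the image of [[0, x]] under a
    leg of [L'], and that leg is [chi] after the leg of [L]. *)
Lemma factor_interval_preserving L L' (chi : lattice L -> lattice L') :
  \bigcup_i range (sval (leg L i)) = setT -> lattice_morphism chi ->
  (forall i x, sval (leg L' i) x = chi (sval (leg L i) x)) ->
  (forall i, interval_preserving (sval (leg L' i) : E i -> lattice L')) ->
  interval_preserving chi.
Proof.
move=> Lcover chiM chiE legI; have chiP := lattice_morphism_positive chiM.
split=> // p p0; apply/seteqP; split=> [_ [q [q0 qp] <-]|q /= qp].
  by split; [exact: chiP|exact: lattice_morphism_lev].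
have [i [x x0 px]] := leg_positive_cover Lcover p0.
have [_ /(_ x x0) legx] := legI i.
move: qp; rewrite px -chiE -legx => -[y [y0 yx] <-].
exists (sval (leg L i) y); last by rewrite chiE.
have legM := leg_lattice_morphism L i.
by split; [exact: lattice_morphism_positive|exact: lattice_morphism_lev].
Qed.

(** The same factorization with closures: the image of [[0, x]] under the leg of [L'] is contained
    in the image of [[0, p]] under [chi]. *)
Lemma factor_almost_interval_preserving L L' (chi : lattice L -> lattice L') :
  \bigcup_i range (sval (leg L i)) = setT -> lattice_morphism chi ->
  (forall i x, sval (leg L' i) x = chi (sval (leg L i) x)) ->
  (forall i, almost_interval_preserving (sval (leg L' i) : E i -> lattice L')) ->
  almost_interval_preserving chi.
Proof.
move=> Lcover chiM chiE legI; have chiP := lattice_morphism_positive chiM.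
split=> // p p0; apply/seteqP; split; last first.
  rewrite -[X in _ `<=` X]order_interval_closed.
  apply: closureS => _ [q [q0 qp] <-].
  by split; [exact: chiP|exact: lattice_morphism_lev].
have [i [x x0 ->]] := leg_positive_cover Lcover p0.
have [_ /(_ x x0) legx] := legI i.
rewrite -chiE legx; apply: closureS => _ [y [y0 yx] <-].
exists (sval (leg L i) y); last by rewrite chiE.
have legM := leg_lattice_morphism L i.
by split; [exact: lattice_morphism_positive|exact: lattice_morphism_lev].
Qed.

End limits_in_NL_LH.

(** * Limits for almost interval preserving lattice homomorphisms *)

Section limits_in_NL_AIPLH.
Variables (R : realType) (I : directedSet) (S : directSystem (NL_AIPLH R) I).
Local Notation lattice L := (apex L : normedLatticeType R).
Let T := image_system (AIPLH_to_LH R) S.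
Let E (i : I) : normedLatticeType R := S i.

Lemma exhausting_NL_AIPLH (L : compatSystem S) :
  exhausting (AIPLH_to_Met R) L -> is_direct_limit L.
Proof.
move=> Lex; apply: is_direct_limit_reflect (exhausting_direct_limit Lex).
  by move=> A B f g fg; apply: concrete_hom_eq; exact: (congr1 sval fg).
move=> L' chi chiL.
have chiE i x : sval (leg L' i) x = sval chi (sval (leg L i) x).
  exact: (congr1 (fun h => sval h x) (chiL i)).
have Lcover : \bigcup_i range (sval (leg L i)) = setT by case: Lex.
have [chiM chiC] : NL_LH_morphism (sval chi : lattice L -> lattice L').
  exact: (@factor_NL_LH_morphism R I T (image_compat (AIPLH_to_LH R) L)
    (image_compat (AIPLH_to_LH R) L') (sval chi) Lcover (svalP chi)).
have chiAM : NL_AIPLH_morphism (sval chi : lattice L -> lattice L').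
  split=> //; apply: (@factor_almost_interval_preserving R I T
    (image_compat (AIPLH_to_LH R) L) (image_compat (AIPLH_to_LH R) L')) => //.
  by move=> i; have [] := svalP (leg L' i).
by exists (exist _ _ chiAM); exact: concrete_hom_eq.
Qed.

(** The germ maps cover the limit, so they inherit almost interval preservation from the
    transitions. Thus the limit built for lattice homomorphisms already lies in the smaller
    category. *)
Lemma germ_NL_AIPLH_morphism i :
  NL_AIPLH_morphism (sval (leg (limit_lattice_system T) i) : E i -> limit_lattice T).
Proof.
have [? ?] := svalP (leg (limit_lattice_system T) i); split=> //.
apply: (@leg_almost_interval_preserving R I T (limit_lattice_system T)) => [|j k jk].
  by case: (limit_lattice_exhausting T).
by have [] := svalP (sys_map S jk).
Qed.

Definition AIPLH_germ_hom i : hom (S i) (limit_lattice T : normedLatticeType R) :=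
  exist _ _ (germ_NL_AIPLH_morphism i).

Lemma AIPLH_germ_hom_compat i j (ij : dle i j) :
  compm (AIPLH_germ_hom j) (sys_map S ij) = AIPLH_germ_hom i.
Proof.
exact/concrete_hom_eq/(congr1 sval (leg_compat (limit_lattice_system T) ij)).
Qed.

Lemma NL_AIPLH_exhausting_system :
  exists L : compatSystem S, exhausting (AIPLH_to_Met R) L.
Proof.
by exists (CompatSystem AIPLH_germ_hom_compat); exact: (limit_lattice_exhausting T).
Qed.

End limits_in_NL_AIPLH.

(** * Limits for interval preserving lattice homomorphisms *)

Section limits_in_NL_IPLH.
Variables (R : realType) (I : directedSet) (S : directSystem (NL_IPLH R) I).
Local Notation lattice L := (apex L : normedLatticeType R).
Let T := image_system (IPLH_to_LH R) S.
Let E (i : I) : normedLatticeType R := S i.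

Lemma exhausting_NL_IPLH (L : compatSystem S) :
  exhausting (IPLH_to_Met R) L -> is_direct_limit L.
Proof.
move=> Lex; apply: is_direct_limit_reflect (exhausting_direct_limit Lex).
  by move=> A B f g fg; apply: concrete_hom_eq; exact: (congr1 sval fg).
move=> L' chi chiL.
have chiE i x : sval (leg L' i) x = sval chi (sval (leg L i) x).
  exact: (congr1 (fun h => sval h x) (chiL i)).
have Lcover : \bigcup_i range (sval (leg L i)) = setT by case: Lex.
have [chiM chiC] : NL_LH_morphism (sval chi : lattice L -> lattice L').
  exact: (@factor_NL_LH_morphism R I T (image_compat (IPLH_to_LH R) L)
    (image_compat (IPLH_to_LH R) L') (sval chi) Lcover (svalP chi)).
have chiIM : NL_IPLH_morphism (sval chi : lattice L -> lattice L').
  split=> //; apply: (@factor_interval_preserving R I T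
    (image_compat (IPLH_to_LH R) L) (image_compat (IPLH_to_LH R) L')) => //.
  by move=> i; have [] := svalP (leg L' i).
by exists (exist _ _ chiIM); exact: concrete_hom_eq.
Qed.

Lemma germ_NL_IPLH_morphism i :
  NL_IPLH_morphism (sval (leg (limit_lattice_system T) i) : E i -> limit_lattice T).
Proof.
have [? ?] := svalP (leg (limit_lattice_system T) i); split=> //.
apply: (@leg_interval_preserving R I T (limit_lattice_system T)) => [|j k jk].
  by case: (limit_lattice_exhausting T).
by have [] := svalP (sys_map S jk).
Qed.

Definition IPLH_germ_hom i : hom (S i) (limit_lattice T : normedLatticeType R) :=
  exist _ _ (germ_NL_IPLH_morphism i).

Lemma IPLH_germ_hom_compat i j (ij : dle i j) :
  compm (IPLH_germ_hom j) (sys_map S ij) = IPLH_germ_hom i.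
Proof.
exact/concrete_hom_eq/(congr1 sval (leg_compat (limit_lattice_system T) ij)).
Qed.

Lemma NL_IPLH_exhausting_system :
  exists L : compatSystem S, exhausting (IPLH_to_Met R) L.
Proof.
by exists (CompatSystem IPLH_germ_hom_compat); exact: (limit_lattice_exhausting T).
Qed.

End limits_in_NL_IPLH.

(** * Direct limits along the chain of categories *)

Lemma exhausting_ranges (R : realType) (I : directedSet) (C : category)
    (F : functor C (Met R)) (S : directSystem C I) (L : compatSystem S) i j :
  dle i j ->
  range (sval (fmap F (leg L i))) `<=` range (sval (fmap F (leg L j))).
Proof.
move=> ij _ [x _ <-]; exists (sval (fmap F (sys_map S ij)) x) => //.
exact: sval_leg_transition.
Qed.

Theorem theorem4p3 (R : realType) (I : directedSet) :
  (forall S : directSystem (NL_IPLH R) I,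
    (exists L : compatSystem S, is_direct_limit L) /\
    forall L : compatSystem S, is_direct_limit L ->
    [/\ \bigcup_i range (sval (leg L i)) = setT,
      forall i j, dle i j -> range (sval (leg L i)) `<=` range (sval (leg L j)),
      forall i, lattice_ideal (range (sval (leg L i)))
    & [/\ is_direct_limit (image_compat (IPLH_to_AIPLH R) L),
      is_direct_limit (image_compat (IPLH_to_LH R) L),
      is_direct_limit (image_compat (IPLH_to_PONS R) L),
      is_direct_limit (image_compat (IPLH_to_NS R) L)
      & is_direct_limit (image_compat (IPLH_to_Met R) L)]]) /\
  (forall S : directSystem (NL_AIPLH R) I,
    (exists L : compatSystem S, is_direct_limit L) /\
    forall L : compatSystem S, is_direct_limit L ->
    [/\ \bigcup_i range (sval (leg L i)) = setT,
      forall i j, dle i j -> range (sval (leg L i)) `<=` range (sval (leg L j)),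
      forall i, vector_sublattice (range (sval (leg L i))),
      forall i, lattice_ideal (closure (range (sval (leg L i))))
    & [/\ is_direct_limit (image_compat (AIPLH_to_LH R) L),
      is_direct_limit (image_compat (AIPLH_to_PONS R) L),
      is_direct_limit (image_compat (AIPLH_to_NS R) L)
      & is_direct_limit (image_compat (AIPLH_to_Met R) L)]]) /\
  (forall S : directSystem (NL_LH R) I,
    (exists L : compatSystem S, is_direct_limit L) /\
    forall L : compatSystem S, is_direct_limit L ->
    [/\ \bigcup_i range (sval (leg L i)) = setT,
      forall i j, dle i j -> range (sval (leg L i)) `<=` range (sval (leg L j)),
      forall i, vector_sublattice (range (sval (leg L i)))
    & [/\ is_direct_limit (image_compat (LH_to_PONS R) L),
      is_direct_limit (image_compat (LH_to_NS R) L)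
      & is_direct_limit (image_compat (LH_to_Met R) L)]]) /\
  (forall S : directSystem (NS R) I,
    (exists L : compatSystem S, is_direct_limit L) /\
    forall L : compatSystem S, is_direct_limit L ->
    [/\ \bigcup_i range (sval (leg L i)) = setT,
      forall i j, dle i j -> range (sval (leg L i)) `<=` range (sval (leg L j)),
      forall i, linear_subspace (range (sval (leg L i)))
    & is_direct_limit (image_compat (NS_to_Met R) L)]).
Proof.
split; [|split; [|split]] => S.
- have [L0 L0ex] := NL_IPLH_exhausting_system S.
  have L0lim := exhausting_NL_IPLH L0ex; split=> [|L Llim]; first by exists L0.
  have Lex := exhausting_iso Llim L0lim L0ex; split.
  + by case: Lex.
  + by move=> i j; exact: (@exhausting_ranges _ _ _ (IPLH_to_Met R) _ L).
  + move=> i; have [legM legI _] := svalP (leg L i).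
    exact: range_lattice_ideal legM legI.
  + split.
    (* The functors keep the underlying maps, so [Lex] is also the criterion for the image of
       [L]. *)
    * by apply: exhausting_NL_AIPLH; exact: Lex.
    * by apply: exhausting_NL_LH; exact: Lex.
    (* The wedge condition holds because the apex and the spaces of the system are lattices. *)
    * apply: exhausting_PONS; first exact: Lex.
      apply: (@leg_positive_cover R I _ (image_compat (IPLH_to_LH R) L)).
      by case: Lex.
    * by apply: exhausting_NS; exact: Lex.
    * exact: (exhausting_direct_limit Lex).
- have [L0 L0ex] := NL_AIPLH_exhausting_system S.
  have L0lim := exhausting_NL_AIPLH L0ex; split=> [|L Llim]; first by exists L0.
  have Lex := exhausting_iso Llim L0lim L0ex; split.
  + by case: Lex.
  + by move=> i j; exact: (@exhausting_ranges _ _ _ (AIPLH_to_Met R) _ L).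
  + move=> i; have [legM _ _] := svalP (leg L i).
    exact: range_vector_sublattice legM.
  + move=> i; have [legM legI _] := svalP (leg L i).
    exact: closure_range_lattice_ideal legM legI.
  + split.
    * by apply: exhausting_NL_LH; exact: Lex.
    * apply: exhausting_PONS; first exact: Lex.
      apply: (@leg_positive_cover R I _ (image_compat (AIPLH_to_LH R) L)).
      by case: Lex.
    * by apply: exhausting_NS; exact: Lex.
    * exact: (exhausting_direct_limit Lex).
- have L0ex := limit_lattice_exhausting S.
  have L0lim := exhausting_NL_LH L0ex.
  split=> [|L Llim]; first by exists (limit_lattice_system S).
  have Lex := exhausting_iso Llim L0lim L0ex; split.
  + by case: Lex.
  + by move=> i j; exact: (@exhausting_ranges _ _ _ (LH_to_Met R) _ L).
  + move=> i; have [legM _] := svalP (leg L i).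
    exact: range_vector_sublattice legM.
  + split.
    * apply: exhausting_PONS; first exact: Lex.
      apply: (@leg_positive_cover R I S L).
      by case: Lex.
    * by apply: exhausting_NS; exact: Lex.
    * exact: (exhausting_direct_limit Lex).
- have L0ex := limit_space_exhausting S; have L0lim := exhausting_NS L0ex.
  split=> [|L Llim]; first by exists (limit_space_system S).
  have Lex := exhausting_iso Llim L0lim L0ex; split.
  + by case: Lex.
  + by move=> i j; exact: (@exhausting_ranges _ _ _ (NS_to_Met R) _ L).
  + move=> i; have [legL _] := svalP (leg L i).
    exact: range_linear_subspace legL.
  + exact: exhausting_direct_limit Lex.
Qed.
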